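(* In the case of Affine Kriging, with a Matérn kernel with smoothness $\nu=1$, the reference prior $\pi(\theta)$ is $O(\theta^{-3}\log(\theta))$ when $\theta\to+\infty$. It is a proper prior distribution, i.e. $\int_0^{+\infty}\pi(\theta)\,d\theta<+\infty$. Furthermore, for every $\boldsymbol y\in\mathbb R^n$ such that $\boldsymbol W^\top\boldsymbol y$ is non-null, the likelihood function $L_{\boldsymbol y}(\theta)$ converges to a non-null constant when $\theta\to+\infty$.
   Context: Let $r\ge1$ and let $\boldsymbol x^{(1)},\dots,\boldsymbol x^{(n)}\in\mathbb R^r$ be distinct fixed points. The Matérn kernel with smoothness $\nu>0$ is $K(0)=1$, $K(t)=\Gamma(\nu)^{-1}2^{1-\nu}(2\sqrt\nu\,t)^\nu\mathcal K_\nu(2\sqrt\nu\,t)$ for $t>0$, with $\mathcal K_\nu$ the modified Bessel function of the second kind. For $\theta>0$, $\boldsymbol\Sigma_\theta$ is the $n\times n$ (positive definite) matrix with $(i,i')$-th element $K(\|\boldsymbol x^{(i)}-\boldsymbol x^{(i')}\|/\theta)$. Affine Kriging: $p=r+1$, $n>p$, and $\boldsymbol H$ is the $n\times(r+1)$ matrix whose first column is the vector of ones $\boldsymbol 1$ and whose last $r$ columns contain the coordinates of the design points (row $i$ is $(1,(\boldsymbol x^{(i)})^\top)$); $\boldsymbol H$ is assumed to have rank $p=r+1$. $\boldsymbol W$ is a fixed $n\times(n-p)$ matrix with $\boldsymbol W^\top\boldsymbol W=\boldsymbol I_{n-p}$ and $\boldsymbol H^\top\boldsymbol W=\boldsymbol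 0$. Put $\boldsymbol\Sigma^{\boldsymbol W}_\theta=\boldsymbol W^\top\boldsymbol\Sigma_\theta\boldsymbol W$. The reference prior on $\theta$ is, up to a positive multiplicative constant, $$\pi(\theta)=\sqrt{\operatorname{Tr}\Big[\Big\{\big(\tfrac{d}{d\theta}\boldsymbol\Sigma^{\boldsymbol W}_\theta\big)(\boldsymbol\Sigma^{\boldsymbol W}_\theta)^{-1}\Big\}^2\Big]-\frac1{n-p}\Big[\operatorname{Tr}\Big\{\big(\tfrac{d}{d\theta}\boldsymbol\Sigma^{\boldsymbol W}_\theta\big)(\boldsymbol\Sigma^{\boldsymbol W}_\theta)^{-1}\Big\}\Big]^2}.$$ The (integrated) likelihood is $L_{\boldsymbol y}(\theta)=\int_0^\infty\int_{\mathbb R^p}(2\pi\sigma^2)^{-n/2}|\boldsymbol\Sigma_\theta|^{-1/2}\exp\{-\frac1{2\sigma^2}(\boldsymbol y-\boldsymbol H\boldsymbol\beta)^\top\boldsymbol\Sigma_\theta^{-1}(\boldsymbol y-\boldsymbol H\boldsymbol\beta)\}\,d\boldsymbol\beta\,\frac{d\sigma^2}{\sigma^2}$, which equals, up to a positive constant not depending on $\theta$, $|\boldsymbol W^\top\boldsymbol\Sigma_\theta\boldsymbol W|^{-1/2}\big(\boldsymbol y^\top\boldsymbol W(\boldsymbol W^\top\boldsymbol\Sigma_\theta\boldsymbol W)^{-1}\boldsymbol W^\top\boldsymbol y\big)^{-(n-p)/2}$. *)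

(* Defs.v *)
From mathcomp Require Import all_boot all_order all_algebra.
From mathcomp Require Import all_classical all_reals all_analysis.

Set Implicit Arguments.
Unset Strict Implicit.
Unset Printing Implicit Defensive.

Import Order.TTheory GRing.Theory Num.Theory.
Import numFieldNormedType.Exports.

Local Open Scope classical_set_scope.
Local Open Scope ring_scope.

(* Lets the Landau notations be used at +oo. *)
Canonical pinfty_filter_on (R : numFieldType) :=
  FilterType (pinfty_nbhs R) (@proper_pinfty_nbhs R).

Definition coshR (R : realType) (t : R) : R := (expR t + expR (- t)) / 2.

(* Euler's integral; meaningful for a > 0. *)
Definition gammaR (R : realType) (a : R) : R :=
  \int[@lebesgue_measure R]_(t in `]0, +oo[) (t `^ (a - 1) * expR (- t)).

(* The modified Bessel function of the second kind, through its integral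
   representation, valid for z > 0 and every real order nu. *)
Definition besselK (R : realType) (nu z : R) : R :=
  \int[@lebesgue_measure R]_(t in `]0, +oo[)
    (expR (- z * coshR t) * coshR (nu * t)).

(* Only used at t >= 0. *)
Definition matern (R : realType) (nu t : R) : R :=
  if t == 0 then 1 else
  (gammaR nu)^-1 * 2 `^ (1 - nu) * (2 * Num.sqrt nu * t) `^ nu *
    besselK nu (2 * Num.sqrt nu * t).

(* The library norm on row vectors is the sup norm, hence this definition. *)
Definition enorm (R : realType) (r : nat) (v : 'rV[R]_r) : R :=
  Num.sqrt (\sum_(k < r) v 0 k ^+ 2).

(* The rows of X are the design points. *)
Definition Sigma (R : realType) (nu : R) (n r : nat) (X : 'M[R]_(n, r))
    (theta : R) : 'M[R]_n :=
  \matrix_(i < n, j < n) matern nu (enorm (row i X - row j X) / theta).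

Definition affineH (R : realType) (n r : nat) (X : 'M[R]_(n, r)) :
    'M[R]_(n, r.+1) :=
  row_mx (const_mx 1 : 'M[R]_(n, 1)) X.

Definition SigmaW (R : realType) (nu : R) (n r m : nat) (X : 'M[R]_(n, r))
    (W : 'M[R]_(n, m)) (theta : R) : 'M[R]_m :=
  W^T *m Sigma nu X theta *m W.

(* Here m stands for n - p, the number of columns of W. *)
Definition refprior (R : realType) (nu : R) (n r m : nat) (X : 'M[R]_(n, r))
    (W : 'M[R]_(n, m)) (theta : R) : R :=
  let A := ((SigmaW nu X W)^`()%classic theta) *m invmx (SigmaW nu X W theta) in
  Num.sqrt (\tr (A *m A) - m%:R^-1 * (\tr A) ^+ 2).

(* Lebesgue integral over R^p as an iterated one-dimensional integral, which is
   legitimate by Tonelli for the nonnegative measurable integrands it is used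
   on. *)
Fixpoint integral_Rn (R : realType) (p : nat) :
    ('cV[R]_p -> \bar R) -> \bar R :=
  match p with
  | 0 => fun f => f 0
  | p'.+1 => fun f => (\int[@lebesgue_measure R]_b
      integral_Rn (fun v : 'cV[R]_p' => f (col_mx (b%:M : 'M[R]_1) v)))%E
  end.

(* The Gaussian density of mean H *m beta and covariance s *: S at y; the
   variance sigma^2 is the variable s. *)
Definition gauss_density (R : realType) (n p : nat) (S : 'M[R]_n)
    (H : 'M[R]_(n, p)) (y : 'cV[R]_n) (s : R) (beta : 'cV[R]_p) : R :=
  (2 * pi * s) `^ (- (n%:R / 2)) * (\det S) `^ (- 2^-1) *
  expR (- (2 * s)^-1 *
    ((y - H *m beta)^T *m invmx S *m (y - H *m beta)) 0 0).

Definition likelihood (R : realType) (nu : R) (n r : nat) (X : 'M[R]_(n, r))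
    (y : 'cV[R]_n) (theta : R) : \bar R :=
  (\int[@lebesgue_measure R]_(s in `]0%R, +oo[)
     (integral_Rn (fun beta : 'cV[R]_r.+1 =>
        (gauss_density (Sigma nu X theta) (affineH X) y s beta)%:E)
      * (s^-1)%:E))%E.

(* Main.v *)
Require Import Defs.
From mathcomp Require Import all_boot all_order all_algebra.
From mathcomp Require Import all_classical all_reals all_analysis.
From mathcomp Require Import measurable_realfun ring lra.
Import Order.TTheory GRing.Theory Num.Theory.
Import numFieldNormedType.Exports.
Local Open Scope classical_set_scope.
Local Open Scope ring_scope.

(** With e = theta^-2, the Matern kernel of smoothness 1 is a scale mixture of
    Gaussian kernels,
      K(d / theta) = e * int_0^oo exp(- e / a) exp(- d^2 a) a^-2 da
    ([matern1_mix]), and the theorem is read off this formula.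

    For a vector v put q(a) = sum_ij v_i v_j exp(- a |x_i - x_j|^2). Gaussian
    kernels are positive semidefinite, so q >= 0, and q(a) tends to |v|^2 > 0 as
    a grows because the design points are distinct; hence Sigma_theta is positive
    definite ([mix_mx_posdef]). If moreover v is orthogonal to the affine
    functions, the constant and linear terms in the expansion of q at 0 vanish,
    because |x_i - x_j|^2 = |x_i|^2 + |x_j|^2 - 2 x_i.x_j, and q(a) = O(a^2)
    ([gauss_form_le]). Consequently W^T Sigma_theta W = e F(e), where
    F(e) = int_0^oo exp(- e / a) a^-2 W^T [exp(- a |x_i - x_j|^2)] W da converges
    to a positive definite matrix as e tends to 0 ([contrast_mx0_posdef]), while
    F'(e) = O(ln (1 / e)) ([sum_mix3_le]).

    The logarithmic derivative of e F(e) with respect to theta is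
    - (2 / theta) I - 2 theta^-3 F'(e) F(e)^-1. The prior is the square root of a
    quadratic function of this matrix that does not see multiples of I
    ([dispersion_affine]), so it equals 2 theta^-3 sqrt(dispersion(F'(e) F(e)^-1)),
    which is O(theta^-3 ln theta) ([refprior_bigO]).

    As theta tends to 0, Sigma_theta tends to I and its derivative to 0
    ([cvg0_Sigma], [cvg0_dSigma]). The prior is therefore continuous on ]0, +oo[
    with a limit at 0, hence bounded by a multiple of 1 / (1 + theta^2), and its
    integral is finite ([integral_lty]).

    Integrating the Gaussian density over beta and substituting s = q / t^2 for
    the variance, with q = w^T A^-1 w, A = W^T Sigma_theta W and w = W^T y, gives a
    constant times det(A)^(-1/2) q^(-m/2) ([integrated_gauss]). This is invariant
    under scaling of A ([profileZ]), so A may be replaced by F(e), whose limit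
    F(0) is positive definite. *)

Set Implicit Arguments.
Unset Strict Implicit.

(** * Positive definite matrices *)

Section PositiveDefinite.
Context {R : realFieldType}.

Definition qform n (M : 'M[R]_n) (v : 'cV[R]_n) : R := (v^T *m M *m v) 0 0.

Definition posdef n (M : 'M[R]_n) : Prop :=
  M^T = M /\ forall v : 'cV[R]_n, v != 0 -> 0 < qform M v.

Lemma qformE n (M : 'M[R]_n) v : qform M v = \sum_i \sum_j v i 0 * v j 0 * M i j.
Proof.
rewrite /qform mxE exchange_big; apply: eq_bigr => j _ /=.
rewrite mxE mulr_suml; apply: eq_bigr => i _; rewrite mxE; ring.
Qed.

Lemma qform1 n (v : 'cV[R]_n) : qform 1%:M v = \sum_i v i 0 ^+ 2.
Proof. by rewrite /qform mulmx1 mxE; apply: eq_bigr => i _; rewrite mxE expr2. Qed.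

Lemma posdef_unit n (M : 'M[R]_n) : posdef M -> M \in unitmx.
Proof.
move=> [symM posM]; rewrite -row_free_unit; apply/inj_row_free => v vM0.
apply/eqP; apply: contraT => v0.
have := posM v^T; rewrite trmx_eq0 => /(_ v0).
by rewrite /qform trmxK vM0 mul0mx mxE ltxx.
Qed.

Lemma posdef_invmx n (M : 'M[R]_n) : posdef M -> posdef (invmx M).
Proof.
move=> pM; have uM := posdef_unit pM; case: pM => symM posM; split.
  by rewrite trmx_inv symM.
move=> v v0; have -> : qform (invmx M) v = qform M (invmx M *m v).
  rewrite /qform trmx_mul trmx_inv symM; congr (fun_of_matrix _ 0 0).
  by rewrite !mulmxA mulmxKV.
apply: posM; apply: contra_neq v0 => Mv0.
by rewrite -(mulKVmx uM v) Mv0 mulmx0.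
Qed.

Lemma posdef_congr n m (M : 'M[R]_n) (B : 'M[R]_(n, m)) :
  (forall v : 'cV_m, B *m v = 0 -> v = 0) -> posdef M -> posdef (B^T *m M *m B).
Proof.
move=> injB [symM posM]; split; first by rewrite !trmx_mul trmxK symM mulmxA.
move=> v v0; have -> : qform (B^T *m M *m B) v = qform M (B *m v).
  by rewrite /qform trmx_mul !mulmxA.
by apply: posM; apply: contra_neq v0; exact: injB.
Qed.

Lemma qform_block n (a x : R) (g : 'rV[R]_n) (P : 'M[R]_n) v :
  qform (block_mx (a%:M : 'M[R]_1) g g^T P) (col_mx (x%:M : 'M[R]_1) v) =
  a * x ^+ 2 + 2 * x * (g *m v) 0 0 + qform P v.
Proof.
rewrite /qform tr_col_mx mul_row_block mul_row_col tr_scalar_mx.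
have e : v^T *m g^T = g *m v.
  by rewrite -trmx_mul [g *m v]mx11_scalar tr_scalar_mx.
rewrite -scalar_mxM mul_scalar_mx !mulmxDl e -scalar_mxM mul_mx_scalar -scalemxAl.
rewrite !mxE eqxx !mulr1n; set s1 := \sum_j _; set s2 := \sum_j _; ring.
Qed.

(** Gaussian elimination of the first variable. It serves both the positivity of
    determinants and the evaluation of iterated Gaussian integrals, which
    integrate one variable at a time. *)
Section Schur.
Context (n : nat) (a : R) (g : 'rV[R]_n) (P : 'M[R]_n).
Local Notation M := (block_mx (a%:M : 'M[R]_1) g g^T P).
Definition schur : R := a - (g *m invmx P *m g^T) 0 0.
Hypothesis pM : posdef M.

Lemma posdef_drsub : posdef P.
Proof.
case: pM => symM posM; split.
  by move: symM; rewrite tr_block_mx => /eq_block_mx[].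
move=> v v0; have := posM (col_mx 0 v); rewrite col_mx_eq0 eqxx v0 => /(_ isT).
rewrite /qform tr_col_mx mul_row_block mul_row_col trmx0 !mul0mx !add0r.
by rewrite mulmx0 add0r.
Qed.

Let uP : P \in unitmx := posdef_unit posdef_drsub.
Let symP : P^T = P. Proof. by case: posdef_drsub. Qed.
Local Notation L := (block_mx (1 : 'M[R]_1) (g *m invmx P) 0 (1%:M : 'M[R]_n)).

Lemma schur_decomp : M = L *m block_mx schur%:M 0 0 P *m L^T.
Proof.
rewrite tr_block_mx trmx1 trmx0 !mulmx_block !(mulmx0, mul0mx, addr0, add0r).
rewrite trmx_mul trmx_inv symP !mul1mx !trmx1 !mulmx1 mulmxKV// mulKVmx//.
congr block_mx; rewrite mulmxA [X in _ = _ + X]mx11_scalar -raddfD/= /schur.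
by rewrite subrK.
Qed.

Lemma det_schur : \det M = schur * \det P.
Proof.
rewrite [LHS](congr1 determinant schur_decomp) !det_mulmx det_tr det_ublock det_ublock !det1.
by rewrite det_scalar1 !mul1r mulr1.
Qed.

Lemma schur_gt0 : 0 < schur.
Proof.
case: pM => symM posM.
have := posM (col_mx 1 (- (invmx P *m g^T))).
rewrite col_mx_eq0 oner_eq0/= => /(_ isT).
rewrite /qform {1}tr_col_mx mul_row_block mul_row_col !trmx1 !mul1mx !mulmx1.
rewrite linearN/= trmx_mul trmxK trmx_inv symP.
rewrite !mulNmx mulmxKV// subrr mul0mx addr0 mxE [X in X + _]mxE eqxx mulr1n.
by rewrite [X in _ + X]mxE.
Qed.

(** The left-hand side is [b; v]^T z for the solution z = [x; w] of M z = [b; v];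
    eliminating w leaves schur * x = b - g P^-1 v. *)
Lemma qform_inv_schur (b : R) (v : 'cV[R]_n) :
  qform (invmx M) (col_mx b%:M v) =
  qform (invmx P) v + (b - (g *m invmx P *m v) 0 0) ^+ 2 / schur.
Proof.
have s0 : schur != 0 by rewrite gt_eqF ?schur_gt0.
have uM := posdef_unit pM.
pose x := (b - (g *m invmx P *m v) 0 0) / schur.
pose w := invmx P *m (v - x *: g^T).
have MK : M *m col_mx x%:M w = col_mx b%:M v.
  rewrite mul_block_col mulKVmx//; congr col_mx; last first.
    by rewrite mul_mx_scalar addrC subrK.
  rewrite -scalar_mxM mulmxA mulmxBr -scalemxAr [_ - _]mx11_scalar -raddfD/=.
  congr (_%:M); rewrite mxE [X in _ + (_ + X)]mxE [X in _ + (_ - X)]mxE.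
  have : x * schur = b - (g *m invmx P *m v) 0 0 by rewrite /x divfK.
  rewrite /schur; lra.
rewrite /qform -mulmxA -MK mulKmx// MK tr_col_mx mul_row_col mxE.
rewrite tr_scalar_mx -scalar_mxM [X in X + _]mxE eqxx mulr1n.
rewrite mulmxA mulmxBr -scalemxAr [X in _ + X]mxE [X in _ + (_ + X)]mxE.
rewrite [X in _ + (_ - X)]mxE.
have -> : (v^T *m invmx P *m g^T) 0 0 = (g *m invmx P *m v) 0 0.
  by rewrite -[in LHS](trmxK (v^T *m _ *m _)) mxE !trmx_mul !trmxK trmx_inv symP mulmxA.
by rewrite /x; field.
Qed.

End Schur.

Lemma posdef_blockP n (M : 'M[R]_(1 + n)) : posdef M ->
  exists a g P, M = block_mx (a%:M : 'M[R]_1) g g^T P.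
Proof.
move=> [symM _]; exists (ulsubmx M 0 0), (ursubmx M), (drsubmx M).
by rewrite -mx11_scalar trmx_ursub symM submxK.
Qed.

Lemma posdef_det_gt0 n (M : 'M[R]_n) : posdef M -> 0 < \det M.
Proof.
elim: n M => [|n IH] M pM; first by rewrite det_mx00.
have [a [g [P MP]]] := posdef_blockP pM; rewrite MP in pM *.
by rewrite det_schur// mulr_gt0 ?schur_gt0// IH//; exact: posdef_drsub pM.
Qed.

(** Integrating a Gaussian vector of covariance S over the trend H beta amounts to
    observing only W^T y. Both identities below come from the basis V = [H | S W],
    for which V^T S^-1 V is block diagonal. *)
Section Profile.
Context (p m : nat) (S : 'M[R]_(p + m)) (H : 'M[R]_(p + m, p)) (W : 'M[R]_(p + m, m)).
Hypotheses (pS : posdef S) (HW : H^T *m W = 0) (WW : W^T *m W = 1%:M)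
  (injH : forall v : 'cV_p, H *m v = 0 -> v = 0).
Let uS := posdef_unit pS.
Let symS : S^T = S := pS.1.
Let WH : W^T *m H = 0. Proof. by rewrite -[LHS]trmxK trmx_mul trmxK HW trmx0. Qed.
Let contrast_inj (v : 'cV_m) : W *m v = 0 -> v = 0.
Proof. by move=> Wv; rewrite -[v]mul1mx -WW -mulmxA Wv mulmx0. Qed.
Local Notation V := (row_mx H (S *m W)).
Local Notation U := (row_mx H W).

Lemma posdef_projected : posdef (W^T *m S *m W).
Proof. exact: posdef_congr. Qed.

Lemma posdef_normal : posdef (H^T *m invmx S *m H).
Proof. by apply: posdef_congr => //; exact: posdef_invmx. Qed.

Lemma posdef_gram : posdef (H^T *m H).
Proof.
rewrite -[H^T]mulmx1; apply: posdef_congr => //; split; first by rewrite trmx1.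
move=> v; rewrite qform1 => v0; rewrite lt_def sumr_ge0 ?andbT => [|i _]; last first.
  exact: sqr_ge0.
apply: contra_neq v0 => /psumr_eq0P h; apply/matrixP => i j; rewrite ord1 mxE.
by apply/eqP; rewrite -sqrf_eq0 h// => k _; exact: sqr_ge0.
Qed.

Let VSV : V^T *m invmx S *m V =
  block_mx (H^T *m invmx S *m H) 0 0 (W^T *m S *m W).
Proof.
rewrite tr_row_mx mul_col_mx mul_col_row !trmx_mul symS -!mulmxA.
by rewrite !mulKVmx// !mulKmx// HW WH.
Qed.

(** The determinant of V is eliminated between V^T S^-1 V, which is block diagonal,
    and [H | W]^T V, which is block triangular; that of [H | W] is known from its
    Gram matrix diag(H^T H, I). *)
Lemma det_profile :
  \det S * \det (H^T *m invmx S *m H) = \det (W^T *m S *m W) * \det (H^T *m H).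
Proof.
have dWSW := posdef_det_gt0 posdef_projected.
have eV : \det V ^+ 2 = \det S * \det (H^T *m invmx S *m H) * \det (W^T *m S *m W).
  have /(congr1 determinant) := VSV; rewrite !det_mulmx det_tr det_ublock det_inv.
  have dS : \det S != 0 by rewrite gt_eqF ?posdef_det_gt0.
  by move=> h; rewrite -mulrA -h; field.
have eU : \det U ^+ 2 = \det (H^T *m H).
  have : U^T *m U = block_mx (H^T *m H) 0 0 1%:M.
    by rewrite tr_row_mx mul_col_row HW WH WW.
  by move/(congr1 determinant); rewrite det_mulmx det_tr det_ublock det1 mulr1 expr2.
have eUV : \det U * \det V = \det (H^T *m H) * \det (W^T *m S *m W).
  have : U^T *m V = block_mx (H^T *m H) (H^T *m (S *m W)) 0 (W^T *m S *m W).
    by rewrite tr_row_mx mul_col_row WH -[W^T *m S *m W]mulmxA.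
  by move/(congr1 determinant); rewrite det_mulmx det_tr det_ublock.
have dHH := posdef_det_gt0 posdef_gram.
have : \det U ^+ 2 * \det V ^+ 2 = (\det (H^T *m H) * \det (W^T *m S *m W)) ^+ 2.
  by rewrite -exprMn eUV.
rewrite eU eV exprMn => h.
apply: (mulfI (lt0r_neq0 dHH)); apply: (mulIf (lt0r_neq0 dWSW)).
rewrite -[LHS]mulrA h; ring.
Qed.

(** Write y = H be + S W ga: the quadratic form splits orthogonally, the part in
    be is the one subtracted, and W^T y only sees ga. *)
Lemma qform_profile (y : 'cV[R]_(p + m)) :
  qform (invmx S) y - qform (invmx (H^T *m invmx S *m H)) (H^T *m invmx S *m y) =
  qform (invmx (W^T *m S *m W)) (W^T *m y).
Proof.
have dWSW := posdef_unit posdef_projected.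
have dHSH := posdef_unit posdef_normal.
have uV : V \in unitmx.
  have : V^T *m invmx S *m V \in unitmx.
    rewrite VSV unitmxE det_ublock unitrM -!unitmxE; exact/andP.
  by rewrite unitmx_mul => /andP[].
have [be [ga ->]] : exists be ga, y = H *m be + S *m W *m ga.
  exists (usubmx (invmx V *m y)), (dsubmx (invmx V *m y)).
  by rewrite -mul_row_col vsubmxK mulKVmx.
have -> : W^T *m (H *m be + S *m W *m ga) = W^T *m S *m W *m ga.
  by rewrite mulmxDr !mulmxA WH mul0mx add0r.
have -> : H^T *m invmx S *m (H *m be + S *m W *m ga) = H^T *m invmx S *m H *m be.
  rewrite mulmxDr !mulmxA -[_ *m invmx S *m S]mulmxA mulVmx// mulmx1 HW.
  by rewrite mul0mx addr0.
have qinv n (M : 'M[R]_n) v : M \in unitmx -> M^T = M -> qform (invmx M) (M *m v) = qform M v.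
  by move=> uM sM; rewrite /qform trmx_mul sM mulmxK// mulmxA.
rewrite !qinv ?(proj1 posdef_projected) ?(proj1 posdef_normal)//.
have -> : H *m be + S *m W *m ga = V *m col_mx be ga by rewrite mul_row_col.
have -> : qform (invmx S) (V *m col_mx be ga) =
    qform (V^T *m invmx S *m V) (col_mx be ga).
  by rewrite /qform trmx_mul !mulmxA.
rewrite VSV /qform tr_col_mx mul_row_block mul_row_col !mulmx0 addr0 add0r.
by rewrite mxE !mulmxA addrAC subrr add0r.
Qed.

End Profile.
End PositiveDefinite.

(** * Gaussian integrals over R^p *)

Section Gaussian.
Context {R : realType}.
Implicit Types c d k : R.

(** The integrand is a multiple of the normal density of mean b / s and variance
    1 / (2 c s). *)
Lemma integral_gauss c (s b : R) d k : 0 < c -> 0 < s -> 0 <= k ->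
  (\int[@lebesgue_measure R]_x
     (k * expR (- c * (s * x ^+ 2 - 2 * b * x + d)))%:E =
   (k * (pi / c) `^ 2^-1 * s `^ (- 2^-1) * expR (- c * (d - b ^+ 2 / s)))%:E)%E.
Proof.
move=> c0 s0 k0.
pose w : R := Num.sqrt (2 * (c * s))^-1.
have w0 : w != 0 by rewrite gt_eqF// sqrtr_gt0 invr_gt0 !mulr_gt0.
have w2 : w ^+ 2 = (2 * (c * s))^-1 by rewrite sqr_sqrtr// invr_ge0 !mulr_ge0// ltW.
have pcs : (0:R) <= pi / c by rewrite divr_ge0 ?pi_ge0 ?ltW.
pose K := k * (pi / c) `^ 2^-1 * s `^ (- 2^-1) * expR (- c * (d - b ^+ 2 / s)).
have K0 : 0 <= K by rewrite !mulr_ge0 ?powR_ge0 ?expR_ge0.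
transitivity (\int[@lebesgue_measure R]_x (K%:E * (normal_pdf (b / s) w x)%:E))%E.
    apply: eq_integral => x _; rewrite -EFinM; congr EFin.
    rewrite normal_pdfE// /normal_peak /normal_fun w2.
    have -> : (2 * (c * s))^-1 * pi *+ 2 = pi / c * s^-1.
      by rewrite -mulr_natr; field; rewrite !gt_eqF.
    rewrite -powR12_sqrt ?mulr_ge0 ?invr_ge0 ?pi_ge0 ?ltW// powRM ?pcs ?invr_ge0 ?ltW//.
    have -> : s^-1 `^ 2^-1 = s `^ (- 2^-1).
      by rewrite -(powR_inv1 (ltW s0)) -powRrM mulN1r.
    rewrite /K.
    have p1 : (pi / c) `^ 2^-1 != 0 :> R by rewrite gt_eqF ?powR_gt0 ?divr_gt0 ?pi_gt0.
    have p2 : s `^ (- 2^-1) != 0 :> R by rewrite gt_eqF ?powR_gt0.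
    rewrite (_ : - c * (s * x ^+ 2 - 2 * b * x + d) =
       - c * (d - b ^+ 2 / s) + - (x - b / s) ^+ 2 / ((2 * (c * s))^-1 *+ 2)).
      by rewrite expRD; field; exact/andP.
    by rewrite -mulr_natr; field; rewrite !gt_eqF ?mulr_gt0.
rewrite ge0_integralZl_EFin//; last 2 first.
- by move=> x _; rewrite lee_fin normal_pdf_ge0.
- by apply/measurable_EFinP; exact: measurable_normal_pdf.
by rewrite integral_normal_pdf// mule1.
Qed.

(** Induction on the dimension: the inner integral is a Gaussian in the first
    coordinate, with leading coefficient the Schur complement. *)
Lemma integral_Rn_gauss p (P : 'M[R]_p) (b : 'cV[R]_p) c d k :
  posdef P -> 0 < c -> 0 <= k ->
  integral_Rn (fun v : 'cV_p =>
    (k * expR (- c * (qform P v - 2 * (b^T *m v) 0 0 + d)))%:E) =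
  (k * (pi / c) `^ (p%:R / 2) * (\det P) `^ (- 2^-1) *
    expR (- c * (d - qform (invmx P) b)))%:E.
Proof.
move=> + c0; elim: p P b d k => [|p IH] P b d k pP k0.
  rewrite /= det_mx00 powR1 mulr1 mul0r powRr0 mulr1.
  by rewrite !qformE !big_ord0 mxE big_ord0 mulr0 subr0 add0r subr0.
have [a [g [Q PQ]]] := posdef_blockP pP; rewrite PQ in pP * => {P PQ}.
have pQ := posdef_drsub pP; have s0 := schur_gt0 pP.
have [symQ _] := pQ.
have [b0 [b1 ->]] : exists b0 b1, b = col_mx (b0%:M : 'M[R]_1) b1 :> 'cV_(1 + p).
  by exists (@usubmx _ 1 p 1 b 0 0), (@dsubmx _ 1 p 1 b); rewrite -mx11_scalar vsubmxK.
rewrite [LHS]/=.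
have entB (A B : 'M[R]_1) : (A - B) 0 0 = A 0 0 - B 0 0 by rewrite !mxE.
have entZ t (A : 'M[R]_1) : (t *: A) 0 0 = t * A 0 0 by rewrite !mxE.
have gQ : (b1^T *m invmx Q *m g^T) 0 0 = (g *m invmx Q *m b1) 0 0.
  by rewrite -[in LHS](trmxK (b1^T *m _ *m _)) mxE !trmx_mul !trmxK trmx_inv symQ mulmxA.
under eq_integral => x _.
  have -> : (fun v : 'cV_p => (k * expR (- c * (qform (block_mx (a%:M : 'M[R]_1) g g^T Q)
      (col_mx x%:M v) - 2 * ((col_mx b0%:M b1)^T *m col_mx x%:M v) 0 0 + d)))%:E) =
    (fun v => (k * expR (- c * (qform Q v - 2 * ((b1 - x *: g^T)^T *m v) 0 0 +
        (a * x ^+ 2 - 2 * b0 * x + d))))%:E).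
    apply/funext => v; congr (_ * expR (_ * _))%:E.
    rewrite qform_block tr_col_mx mul_row_col tr_scalar_mx -scalar_mxM.
    have -> : (b1 - x *: g^T)^T = b1^T - x *: g by rewrite linearB/= linearZ/= trmxK.
    rewrite mulmxBl -scalemxAl.
    rewrite [X in _ - 2 * X + _ = _]mxE [X in _ - 2 * (X + _) + _ = _]mxE eqxx mulr1n.
    rewrite [X in _ = _ - 2 * X + _]mxE [X in _ = _ - 2 * (_ + X) + _]mxE.
    rewrite [X in _ = _ - 2 * (_ - X) + _]mxE; ring.
  rewrite IH//.
  rewrite (_ : a * x ^+ 2 - 2 * b0 * x + d - qform (invmx Q) (b1 - x *: g^T) =
     schur a g Q * x ^+ 2 - 2 * (b0 - (g *m invmx Q *m b1) 0 0) * x +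
      (d - qform (invmx Q) b1)); last first.
    have -> : qform (invmx Q) (b1 - x *: g^T) = ((b1^T - x *: g) *m invmx Q *m (b1 - x *: g^T)) 0 0.
      by rewrite /qform [_^T]linearB/= [(_ *: _)^T]linearZ/= trmxK.
    rewrite !(mulmxBl, mulmxBr) -!(scalemxAl, scalemxAr).
    rewrite !entB !entZ gQ /qform /schur; ring.
  over.
rewrite integral_gauss//; last by rewrite !mulr_ge0 ?powR_ge0.
have pc0 : pi / c != 0 :> R by rewrite gt_eqF ?divr_gt0 ?pi_gt0.
rewrite (det_schur pP) (qform_inv_schur pP).
rewrite [(schur _ _ _ * _) `^ _]powRM ?(ltW s0) ?(ltW (posdef_det_gt0 pQ))//.
have -> : p.+1%:R / 2 = p%:R / 2 + 2^-1 :> R by rewrite -natr1 mulrDl mul1r.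
rewrite powRD ?pc0 ?implybT// opprD addrA; congr (_%:E); ring.
Qed.
End Gaussian.

(** * Change of variables on the half-line *)

Section Substitution.
Context {R : realType}.
Notation mu := (@lebesgue_measure R).
Implicit Types F f G : R -> R.

(** Exhaust ]0, +oo[ by the segments [1/(n+1), n+1]: on each of them the
    substitution is the one for continuous functions on a segment, and both sides
    converge monotonically. *)
Lemma ge0_substitution_decreasing F f G (E : set R) :
  (forall x : R, 0 < x -> is_derive x 1 F (f x)) ->
  (forall x : R, 0 < x -> f x < 0) ->
  (forall x : R, 0 < x -> {for x, continuous f}) ->
  (forall x : R, 0 < x -> E (F x)) ->
  (forall y : R, E y -> exists2 x : R, 0 < x & F x = y) ->
  (forall y : R, E y -> {for y, continuous G}) ->
  (forall y : R, E y -> 0 <= G y) ->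
  (\int[mu]_(y in E) (G y)%:E = \int[mu]_(x in `]0%R, +oo[) (G (F x) * - f x)%:E)%E.
Proof.
move=> dF f0 cf FE EF cG G0.
have cF (x : R) : 0 < x -> {for x, continuous F}.
  by move=> x0; apply/differentiable_continuous/derivable1_diffP; case: (dF _ x0).
have dec (x y : R) : 0 < x -> x < y -> F y < F x.
  move=> x0 xy.
  have [z||] := @MVT _ F f x y xy.
  - by rewrite in_itv/= => /andP[xz _]; apply: dF; apply: lt_trans xz.
  - apply: derivable_within_continuous => z; rewrite in_itv/= => /andP[xz _].
    by have [] := dF z (lt_le_trans x0 xz).
  move=> z; rewrite in_itv/= => /andP[xz _] e; rewrite -subr_lt0 e.
  by rewrite nmulr_rlt0 ?subr_gt0// f0// (lt_trans x0 xz).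
have ndec (x y : R) : 0 < x -> x <= y -> F y <= F x.
  by move=> x0; rewrite le_eqVlt => /predU1P[->//|xy]; exact/ltW/dec.
pose A n : set R := [set` `[n.+1%:R^-1, n.+1%:R]].
pose B n : set R := [set` `[F n.+1%:R, F n.+1%:R^-1]].
have Vle n : n.+1%:R^-1 <= n.+1%:R :> R.
  by rewrite (@le_trans _ _ 1)// ?invf_le1 ?ler1n.
have A0 n x : A n x -> 0 < x.
  by rewrite /A/= in_itv/= => /andP[+ _]; apply: lt_le_trans; rewrite invr_gt0.
have Ale n (x : R) : 0 < x -> (x + x^-1 <= n.+1%:R) -> A n x.
  move=> x0 xn; rewrite /A/= in_itv/=; apply/andP; split.
    rewrite -[leRHS]invrK lef_pV2 ?posrE ?invr_gt0//.
    by rewrite (le_trans _ xn)// lerDr ltW.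
  by rewrite (le_trans _ xn)// lerDl invr_ge0 ltW.
have AU : \bigcup_n A n = [set` `]0, +oo[].
  apply/seteqP; split => [x [n _ /A0]|x]; rewrite /= in_itv/= andbT// => x0.
  exists (Num.truncn (x + x^-1)) => //; apply: Ale => //.
  by apply/ltW; rewrite truncnS_gt.
have ndA m n : (m <= n)%N -> A m `<=` A n.
  move=> mn; apply: subset_itv; rewrite bnd_simp ?lef_pV2 ?posrE// ler_nat ltnS//.
have ndB m n : (m <= n)%N -> B m `<=` B n.
  move=> mn; apply: subset_itv; rewrite bnd_simp.
    by apply: ndec => //; rewrite ler_nat.
  by apply: ndec; rewrite ?invr_gt0// lef_pV2 ?posrE// ler_nat.
have BE n : B n `<=` E.
  move=> y; rewrite /B/= in_itv/= => /andP[y1 y2].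
  have : {within A n, continuous F}.
    apply: derivable_within_continuous => z; rewrite in_itv/= => /andP[xz _].
    by have [] := dF z (lt_le_trans _ xz); rewrite ?invr_gt0.
  move=> /(@IVT _ F _ _ y (Vle n)) []; first by rewrite ge_min y1 orbT le_max y2.
  move=> x xA <-; apply: FE; exact: (A0 n).
have BU : \bigcup_n B n = E.
  apply/seteqP; split => [y [n _ /BE]//|y /EF[x x0 <-]].
  have /Ale : x + x^-1 <= (Num.truncn (x + x^-1)).+1%:R by apply/ltW; rewrite truncnS_gt.
  move=> /(_ x0); rewrite /A/= in_itv/= => /andP[xn nx].
  exists (Num.truncn (x + x^-1)) => //; rewrite /B/= in_itv/=.
  by rewrite ndec//= ndec ?invr_gt0.
have F'f (x : R) : 0 < x -> (F^`()%classic) x = f x.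
  by move=> x0; rewrite derive1E; have [] := dF x x0.
have F'near (x : R) : 0 < x -> {near x, f =1 (F^`()%classic)}.
  move=> x0; near=> z; rewrite F'f//; near: z; exact: lt_nbhsr.
have cF' (x : R) : 0 < x -> (F^`()%classic) z @[z --> x] --> (F^`()%classic) x.
  move=> x0; rewrite F'f//; apply: cvg_trans (cf _ x0).
  exact/near_eq_cvg/F'near.
have ABn n : (\int[mu]_(y in B n) (G y)%:E = \int[mu]_(x in A n) (G (F x) * - f x)%:E)%E.
  rewrite integration_by_substitution_decreasing ?Vle//.
  - apply: eq_integral => x; rewrite inE => /A0 x0.
    by rewrite !fctE F'f.
  - move=> x y xA yA xy; apply: dec => //.
    by apply: (A0 n).
  - move=> x; rewrite in_itv/= => /andP[nx _]; apply: cF'.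
    by apply: lt_trans nx; rewrite invr_gt0.
  - by apply/cvg_ex; eexists; apply: cvg_at_right_filter; apply: cF'; rewrite invr_gt0.
  - by apply/cvg_ex; eexists; apply: cvg_at_left_filter; exact: cF'.
  - split => [x|//|//].
    + rewrite in_itv/= => /andP[nx _].
      by have [] := dF x (lt_trans _ nx); rewrite ?invr_gt0.
    + by apply: cvg_at_right_filter; apply: cF; rewrite invr_gt0.
    + by apply: cvg_at_left_filter; apply: cF.
  - apply: continuous_in_subspaceT => y; rewrite inE => /BE; exact: cG.
have cvA : (\int[mu]_(x in A n) (G (F x) * - f x)%:E @[n --> \oo] -->
    \int[mu]_(x in \bigcup_n A n) (G (F x) * - f x)%:E)%E.
  apply: ge0_nondecreasing_set_cvg_integral.
  - by move=> m n mn; rewrite subsetEset; exact: ndA.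
  - by move=> n; exact: measurable_itv.
  - move=> n; apply/measurable_EFinP.
    apply: subspace_continuous_measurable_fun; first exact: measurable_itv.
    apply: continuous_in_subspaceT => x; rewrite inE => /A0 x0.
    apply: cvgM; last by apply: cvgN; exact: cf.
    by apply: continuous_comp; [exact: cF|apply: cG; exact: FE].
  - move=> n x /A0 x0; rewrite lee_fin mulr_ge0//; first exact/G0/FE.
    by rewrite oppr_ge0 ltW ?f0.
have cvB : (\int[mu]_(x in B n) (G x)%:E @[n --> \oo] -->
    \int[mu]_(x in \bigcup_n B n) (G x)%:E)%E.
  apply: ge0_nondecreasing_set_cvg_integral.
  - by move=> m n mn; rewrite subsetEset; exact: ndB.
  - by move=> n; exact: measurable_itv.
  - move=> n; apply/measurable_EFinP.
    apply: subspace_continuous_measurable_fun; first exact: measurable_itv.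
    by apply: continuous_in_subspaceT => y; rewrite inE => /BE; exact: cG.
  - by move=> n y /BE; rewrite lee_fin; exact: G0.
rewrite -BU -AU; apply: cvg_unique cvB _ => //.
rewrite (_ : (fun n => _) = (fun n => \int[mu]_(x in A n) (G (F x) * - f x)%:E)%E) //.
exact/funext.
Unshelve. all: by end_near. Qed.
(** Precompose F with the inversion x |-> x^-1, which makes it decreasing, then
    undo the inversion by a second decreasing substitution. *)
Lemma ge0_substitution_increasing F f G (E : set R) :
  (forall x : R, 0 < x -> is_derive x 1 F (f x)) ->
  (forall x : R, 0 < x -> 0 < f x) ->
  (forall x : R, 0 < x -> {for x, continuous f}) ->
  (forall x : R, 0 < x -> E (F x)) ->
  (forall y : R, E y -> exists2 x : R, 0 < x & F x = y) ->
  (forall y : R, E y -> {for y, continuous G}) ->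
  (forall y : R, E y -> 0 <= G y) ->
  (\int[mu]_(y in E) (G y)%:E = \int[mu]_(x in `]0%R, +oo[) (G (F x) * f x)%:E)%E.
Proof.
move=> dF f0 cf FE EF cG G0.
have cF (x : R) : 0 < x -> {for x, continuous F}.
  by move=> x0; apply/differentiable_continuous/derivable1_diffP; case: (dF _ x0).
have dV (x : R) : 0 < x -> is_derive x 1 (fun x : R => x^-1) (- x ^- 2).
  move=> x0; have x1 : x != 0 by rewrite gt_eqF.
  by apply: (is_derive_eq (is_deriveV (f := id) x1 _)); rewrite scaler1.
have cV2 (x : R) : 0 < x -> {for x, continuous (fun x : R => x ^- 2)}.
  move=> x0; apply: continuous_comp; first exact: exprn_continuous.
  by apply: inv_continuous; rewrite gt_eqF ?exprn_gt0.
have cV (x : R) : 0 < x -> {for x, continuous (fun x : R => x^-1)}.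
  by move=> x0; apply: inv_continuous; rewrite gt_eqF.
have V0 (x : R) : 0 < x -> 0 < x^-1 by rewrite invr_gt0.
transitivity (\int[mu]_(x in `]0%R, +oo[) (G (F x^-1) * - (f x^-1 * - x ^- 2))%:E)%E; last first.
  transitivity (\int[mu]_(x in `]0%R, +oo[) (G (F x^-1) * f x^-1 * - (- x ^- 2))%:E)%E;
    first by apply: eq_integral => x _; rewrite [f _ * _]mulrN !opprK mulrA.
  apply/esym/(@ge0_substitution_decreasing (fun x => x^-1) (fun x => - x ^- 2)
     (fun u => G (F u) * f u)).
  + by move=> x x0; rewrite oppr_lt0 invr_gt0 exprn_gt0.
  + by move=> x x0; apply: cvgN; exact: cV2.
  + by move=> x x0; rewrite /= in_itv/= V0.
  + by move=> y; rewrite /= in_itv/= andbT => y0; exists y^-1; rewrite ?V0 ?invrK.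
  + move=> y; rewrite /= in_itv/= andbT => y0; apply: cvgM; last exact: cf.
    by apply: continuous_comp; [exact: cF|apply: cG; exact: FE].
  + move=> y; rewrite /= in_itv/= andbT => y0; rewrite mulr_ge0//; first exact/G0/FE.
    by rewrite ltW ?f0.
apply: ge0_substitution_decreasing => //.
- move=> x x0; exact: is_derive1_comp (dF _ (V0 _ x0)) (dV _ x0).
- by move=> x x0; rewrite mulrN oppr_lt0 mulr_gt0 ?invr_gt0 ?exprn_gt0 ?f0 ?V0.
- move=> x x0; apply: cvgM; last by apply: cvgN; exact: cV2.
  by apply: continuous_comp; [exact: cV|exact/cf/V0].
- by move=> x x0; exact/FE/V0.
- by move=> y /EF[x x0 <-]; exists x^-1; rewrite ?V0 ?invrK.
Qed.
End Substitution.

(** * Integrals over the half-line *)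

Section HalfLine.
Context {R : realType}.
Notation mu := (@lebesgue_measure R).
Notation Rpos := (`]0%R, +oo[%classic : set R).
Implicit Types f g : R -> R.

Lemma RposE (x : R) : Rpos x = (0 < x) :> Prop.
Proof. by rewrite /= in_itv/= andbT. Qed.

Lemma measurable_pos f : (forall x : R, 0 < x -> {for x, continuous f}) ->
  measurable_fun Rpos f.
Proof.
move=> cf; apply: open_continuous_measurable_fun; first exact: interval_open.
by move=> x; rewrite inE RposE; exact: cf.
Qed.

Lemma integrable_oneDsqrV : mu.-integrable Rpos (EFin \o (fun x : R => (1 + x ^+ 2)^-1)).
Proof.
have c : continuous (fun x : R => (1 + x ^+ 2)^-1) := @continuous_oneDsqrV R.
apply/integrableP; split.
  by apply/measurable_EFinP; apply: measurable_pos => x _; exact: c.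
under eq_integral => x _.
  rewrite /= ger0_norm ?invr_ge0 ?addr_ge0 ?sqr_ge0//; over.
rewrite integral_itv_obnd_cbnd; last first.
  by apply/measurable_EFinP; apply: measurable_pos => x _; exact: c.
by have := @integral0y_oneDsqr R; rewrite /oneDsqr => ->; rewrite ltry.
Qed.

Lemma integrable_oneDsqrVZ C :
  mu.-integrable Rpos (EFin \o (fun x : R => C / (1 + x ^+ 2))).
Proof.
have : mu.-integrable Rpos
    (fun x : R => C%:E * ((1 + x ^+ 2)^-1)%:E)%E.
  by apply: integrableZl => //; exact: integrable_oneDsqrV.
by apply: eq_integrable => // x _; rewrite /= EFinM.
Qed.

Lemma Rintegral_oneDsqrV : \int[mu]_(x in Rpos) (1 + x ^+ 2)^-1 = pi / 2.
Proof.
have c : continuous (fun x : R => (1 + x ^+ 2)^-1) := @continuous_oneDsqrV R.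
rewrite /Rintegral integral_itv_obnd_cbnd; last first.
  by apply/measurable_EFinP; apply: measurable_pos => x _; exact: c.
by have := @integral0y_oneDsqr R; rewrite /oneDsqr => ->.
Qed.

Lemma le_integrable_pos f g : (forall x : R, 0 < x -> {for x, continuous f}) ->
  mu.-integrable Rpos (EFin \o g) -> (forall x : R, 0 < x -> `|f x| <= g x) ->
  mu.-integrable Rpos (EFin \o f).
Proof.
move=> cf ig fg; apply: (le_integrable _ _ _ ig) => //.
  by apply/measurable_EFinP; exact: measurable_pos.
move=> x; rewrite RposE => x0; rewrite lee_fin (le_trans (fg _ x0))//.
exact: ler_norm.
Qed.

(** 1 / (1 + a^2), the derivative of the arctangent, serves as the dominating
    function for the mixture integrals, the moments and the prior. *)
Lemma integrable_pos f C : (forall x : R, 0 < x -> {for x, continuous f}) ->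
  (forall x : R, 0 < x -> `|f x| <= C / (1 + x ^+ 2)) ->
  mu.-integrable Rpos (EFin \o f).
Proof.
move=> cf fC; apply: le_integrable_pos cf _ fC.
exact: integrable_oneDsqrVZ.
Qed.

Lemma le_Rintegral_pos f C : (forall x : R, 0 < x -> {for x, continuous f}) ->
  (forall x : R, 0 < x -> `|f x| <= C / (1 + x ^+ 2)) ->
  `|\int[mu]_(x in Rpos) f x| <= C * (pi / 2).
Proof.
move=> cf fC; have intf := integrable_pos cf fC.
apply: le_trans (le_normr_Rintegral _ intf) _ => //.
rewrite -Rintegral_oneDsqrV -RintegralZl//; last exact: integrable_oneDsqrV.
apply: le_Rintegral => //.
- exact: integrable_norm.
- exact: integrable_oneDsqrVZ.
- by move=> x; rewrite RposE; exact: fC.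
Qed.

Lemma Rintegral_pos_gt0 f x0 : (forall x : R, 0 < x -> {for x, continuous f}) ->
  mu.-integrable Rpos (EFin \o f) -> (forall x : R, 0 < x -> 0 <= f x) ->
  0 < x0 -> 0 < f x0 -> 0 < \int[mu]_(x in Rpos) f x.
Proof.
move=> cf intf f0 x00 fx0.
have : \forall x \near x0, f x0 / 2 <= f x.
  near=> x; apply/ltW; near: x; apply: (cvgr_gt (f x0)); first exact: cf.
  by rewrite ltr_pdivrMr// ltr_pMr// ltr1n.
move=> [d /= d0 dP].
have d20 : 0 < d / 2 by rewrite divr_gt0.
pose I := `[x0, x0 + d / 2]%classic.
have sub : I `<=` Rpos.
  by move=> x; rewrite RposE /I/= in_itv/= => /andP[+ _]; apply: lt_le_trans.
have mf : measurable_fun Rpos (EFin \o f) by case/integrableP : intf.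
have lb : ((f x0 / 2 * (d / 2))%:E <= \int[mu]_(x in Rpos) (f x)%:E)%E.
  apply: (@le_trans _ _ (\int[mu]_(x in I) (f x0 / 2)%:E)%E).
    rewrite integral_cst; last exact: measurable_itv.
    rewrite /I/= lebesgue_measure_itv/= lte_fin ltrDl d20.
    by rewrite -EFinD -EFinM addrAC subrr add0r.
  apply: (@le_trans _ _ (\int[mu]_(x in I) (f x)%:E)%E).
    apply: ge0_le_integral => //.
    - exact: measurable_itv.
    - by move=> x _; rewrite lee_fin divr_ge0// ltW.
    - by apply: measurable_funS mf => //; exact: measurable_itv.
    - move=> x; rewrite /I/= in_itv/= => /andP[x1 x2]; rewrite lee_fin.
      apply: dP; rewrite /= distrC ger0_norm ?subr_ge0//.
      by rewrite ltrBlDl (le_lt_trans x2)// ltrD2l ltr_pdivrMr// ltr_pMr// ltr1n.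
  apply: ge0_subset_integral => //; first exact: measurable_itv.
  by move=> x; rewrite RposE lee_fin; exact: f0.
rewrite /Rintegral -lte_fin fineK ?integrable_fin_num//.
by apply: lt_le_trans lb; rewrite lte_fin mulr_gt0// divr_gt0.
Unshelve. all: by end_near. Qed.

Lemma exprn_le_expR n (x : R) : 0 <= x -> x ^+ n <= n`!%:R * expR x.
Proof.
move=> x0; case: n => [|n]; first by rewrite expr0 fact0 mul1r -expR0 ler_expR.
rewrite mulrC -ler_pdivrMr ?ltr0n ?fact_gt0//.
by apply: le_trans (expR_ge1Dxn n x0); rewrite lerDr.
Qed.

Lemma integral_expRN : (\int[mu]_(x in Rpos) (expR (- x))%:E = 1)%E.
Proof.
have c : continuous (fun x : R => expR (- x)).
  move=> x; apply: continuous_comp; [exact: opp_continuous|exact: continuous_expR].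
rewrite integral_itv_obnd_cbnd; last first.
  by apply/measurable_EFinP; apply: measurable_pos => x _; exact: c.
have d (x : R) : is_derive x 1 (fun x : R => - expR (- x)) (expR (- x)).
  by apply: is_derive_eq; rewrite mulrN1 opprK.
rewrite (@ge0_continuous_FTC2y _ _ (fun x => - expR (- x)) _ 0)//.
- by rewrite oppr0 expR0 EFinN oppeK add0e.
- by apply: continuous_subspaceT.
- by rewrite -oppr0; apply: cvgN; exact: cvgr_expR.
- by apply: cvg_at_right_filter; apply: cvgN; exact: c.
- by move=> x _; rewrite derive1E; exact: derive_val.
Qed.

Lemma gammaR1 : gammaR 1 = 1 :> R.
Proof.
rewrite /gammaR /Rintegral -[RHS](_ : fine 1%E = 1)// -integral_expRN; congr fine.
by apply: eq_integral => x _; rewrite subrr powRr0 mul1r.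
Qed.

End HalfLine.

(** * Scale mixtures of exponentials *)

Section GaussianMixture.
Context {R : realType}.
Notation mu := (@lebesgue_measure R).
Notation Rpos := (`]0%R, +oo[%classic : set R).

(** exp(- e / a) a^-k is the mixing weight and exp(- c a) the Gaussian kernel at
    squared distance c. Each derivative in e increments k. *)
Definition mix_density (k : nat) (c e a : R) : R :=
  expR (- (e / a)) * expR (- (c * a)) * a ^- k.

Definition mix (k : nat) (c e : R) : R := \int[mu]_(a in Rpos) mix_density k c e a.

Lemma mix_density_ge0 k c e (a : R) : 0 < a -> 0 <= mix_density k c e a.
Proof.
by move=> a0; rewrite /mix_density !mulr_ge0 ?expR_ge0// invr_ge0 exprn_ge0// ltW.
Qed.

Lemma continuous_mix_density k c e (a : R) : 0 < a -> {for a, continuous (mix_density k c e)}.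
Proof.
move=> a0; have an0 : a != 0 by rewrite gt_eqF.
apply: cvgM; first apply: cvgM.
- apply: (cvg_comp _ expR); last exact: continuous_expR.
  by apply: cvgN; apply: cvgM; [exact: cvg_cst|exact: inv_continuous].
- apply: (cvg_comp _ expR); last exact: continuous_expR.
  by apply: cvgN; apply: cvgM; [exact: cvg_cst|exact: cvg_id].
- apply: (@continuous_comp _ _ _ (fun a : R => a ^+ k) GRing.inv).
    exact: exprn_continuous.
  by apply: inv_continuous; rewrite expf_neq0.
Qed.

(** The weight exp(- e / a) absorbs any power of 1 / a near 0, since
    x^k <= k! exp x. *)
Lemma expRN_le k (e0 e a : R) : 0 < e0 -> e0 <= e -> 0 < a ->
  expR (- (e / a)) * a ^- k <= k`!%:R * e0 ^- k.
Proof.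
move=> e00 ee a0; have p : (0:R) < e0 ^+ k * a ^- k by rewrite mulr_gt0 ?invr_gt0 ?exprn_gt0.
rewrite ler_pdivlMr ?exprn_gt0// mulrAC -mulrA expRN.
rewrite ler_pdivrMl ?expR_gt0// [leRHS]mulrC.
apply: (@le_trans _ _ (k`!%:R * expR (e0 / a))).
  apply: le_trans (exprn_le_expR k _); last by rewrite divr_ge0// ltW.
  by rewrite expr_div_n mulrC.
by rewrite ler_wpM2l ?ler0n// ler_expR ler_pM2r ?invr_gt0.
Qed.

(** The two terms bound the integrand multiplied by 1 and by a^2. *)
Definition mix_density_bound k (e : R) : R := k.+2`!%:R * e ^- k.+2 + k`!%:R * e ^- k.

Lemma mix_density_bound_ge0 k (e : R) : 0 < e -> 0 <= mix_density_bound k e.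
Proof. by move=> e0; rewrite addr_ge0// mulr_ge0// invr_ge0 exprn_ge0// ltW. Qed.

Lemma mix_density_le k c (e0 e a : R) : 0 <= c -> 0 < e0 -> e0 <= e -> 0 < a ->
  `|mix_density k.+2 c e a| <= mix_density_bound k e0 / (1 + a ^+ 2).
Proof.
move=> c0 e00 ee a0; have a20 : 0 < 1 + a ^+ 2 by rewrite ltr_wpDr ?sqr_ge0.
rewrite ger0_norm ?mix_density_ge0// ler_pdivlMr//.
apply: (@le_trans _ _ (expR (- (e / a)) * a ^- k.+2 * (1 + a ^+ 2))).
  rewrite ler_pM2r// /mix_density ler_pM2r ?invr_gt0 ?exprn_gt0//.
  rewrite ler_piMr ?expR_ge0// -expR0 ler_expR oppr_le0.
  by rewrite mulr_ge0// ltW.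
rewrite mulrDr mulr1 -mulrA.
have -> : a ^- k.+2 * a ^+ 2 = a ^- k.
  by rewrite !exprS expr0 mulr1; field; rewrite ?expf_neq0 ?gt_eqF.
by rewrite lerD ?expRN_le.
Qed.

Lemma integrable_mix_density k (c e : R) : 0 <= c -> 0 < e ->
  mu.-integrable Rpos (EFin \o mix_density k.+2 c e).
Proof.
move=> c0 e0; apply: (@integrable_pos _ _ (mix_density_bound k e)).
  by move=> x x0; exact: continuous_mix_density.
by move=> x x0; exact: mix_density_le.
Qed.

Lemma is_derive_mix_density k c (a e : R) : 0 < a ->
  is_derive e 1 (fun e => mix_density k c e a) (- mix_density k.+1 c e a).
Proof.
move=> a0; rewrite /mix_density.
by apply: is_derive_eq; rewrite /GRing.scale/= exprS; field; rewrite ?expf_neq0 ?gt_eqF.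
Qed.

(** Differentiation under the integral on ]e / 2, e + 1[, where the dominating
    function of [mix_density_le] is uniform. *)
Lemma is_derive_mix k (c e : R) : 0 <= c -> 0 < e ->
  is_derive e 1 (mix k.+2 c) (- mix k.+3 c e).
Proof.
move=> c0 e0.
have e20 : 0 < e / 2 by rewrite divr_gt0.
pose u := e / 2; pose v := e + 1.
have Iae : `]u, v[%classic e.
  by rewrite /= in_itv/= /u /v ltrDl ltr01 andbT ltr_pdivrMr// ltr_pMr// ltr1n.
have I0 x : `]u, v[%classic x -> e / 2 < x.
  by rewrite /= in_itv/= => /andP[].
have intf x : `]u, v[%classic x -> mu.-integrable Rpos (EFin \o mix_density k.+2 c x).
  by move=> /I0 ux; apply: integrable_mix_density => //; apply: lt_trans ux.
have d1 x y : `]u, v[%classic x -> Rpos y -> derivable (fun x => mix_density k.+2 c x y) x 1.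
  move=> _; rewrite RposE => y0; have d := is_derive_mix_density k.+2 c x y0.
  exact: ex_derive.
have d1E x y : Rpos y -> partial1of2 (mix_density k.+2 c) x y = - mix_density k.+3 c x y.
  rewrite RposE partial1of2E => y0; have d := is_derive_mix_density k.+2 c x y0.
  exact: derive_val.
pose G y := mix_density_bound k.+1 u / (1 + y ^+ 2).
have G0 y : 0 <= G y by rewrite divr_ge0 ?mix_density_bound_ge0// addr_ge0 ?sqr_ge0.
have intG : mu.-integrable Rpos (EFin \o G) := integrable_oneDsqrVZ _.
have Gub x y : `]u, v[%classic x -> Rpos y -> `|partial1of2 (mix_density k.+2 c) x y| <= G y.
  move=> /I0 ux yp; rewrite d1E// normrN; move: yp; rewrite RposE => y0.
  exact/mix_density_le/y0/ltW.
apply: DeriveDef.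
  exact: (derivable_under_integral _ Iae intf d1 G0 intG Gub).
rewrite -derive1E (differentiation_under_integral _ Iae intf d1 G0 intG Gub)//.
transitivity (\int[mu]_(a in Rpos) (-1 * mix_density k.+3 c e a)).
  by apply: eq_Rintegral => y; rewrite inE => yp; rewrite d1E// mulN1r.
by rewrite RintegralZl ?mulN1r//; exact: integrable_mix_density.
Qed.

Lemma mix_ge0 k (c e : R) : 0 <= mix k c e.
Proof. by apply: Rintegral_ge0 => x; rewrite RposE; exact: mix_density_ge0. Qed.

Lemma mix_le k (c e : R) : 0 < c -> 0 < e ->
  mix k c e <= k`!%:R * e ^- k * ((1 + (2 / c ^+ 2)) * (pi / 2)).
Proof.
move=> c0 e0; rewrite -[leLHS]ger0_norm ?mix_ge0// mulrA.
apply: le_Rintegral_pos; first by move=> x x0; exact: continuous_mix_density.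
move=> x x0; rewrite ger0_norm ?mix_density_ge0// /mix_density mulrAC -[leRHS]mulrA.
apply: ler_pM => //; [|exact: expRN_le|].
  by rewrite mulr_ge0 ?expR_ge0// invr_ge0 exprn_ge0// ltW.
have x20 : 0 < 1 + x ^+ 2 by rewrite ltr_wpDr ?sqr_ge0.
rewrite expRN ler_pdivlMr// ler_pdivrMl ?expR_gt0//.
rewrite mulrDr mulr1 lerD//.
  by rewrite -expR0 ler_expR mulr_ge0// ltW.
rewrite mulrA ler_pdivlMr ?exprn_gt0// -exprMn [leRHS]mulrC [x * c]mulrC.
by have := @exprn_le_expR R 2 (c * x); apply; rewrite mulr_ge0 ?ltW.
Qed.

End GaussianMixture.

(** * The Matern kernel as a scale mixture *)

Section MaternMixture.
Context {R : realType}.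
Notation mu := (@lebesgue_measure R).
Notation Rpos := (`]0%R, +oo[%classic : set R).

(** At distance 0 the kernel is 1: substitute s = e / a in the integral of
    exp(- s). *)
Lemma mix_diag (e : R) : 0 < e -> e * mix 2 0 e = 1.
Proof.
move=> e0; rewrite /mix -RintegralZl//; last exact: integrable_mix_density.
rewrite /Rintegral -[RHS](_ : fine 1%E = 1)// -(@integral_expRN R); congr fine.
have dF (x : R) : 0 < x -> is_derive x 1 (fun x => e / x) (- (e / x ^+ 2)).
  move=> x0; have x1 : x != 0 by rewrite gt_eqF.
  have dV := is_deriveV (f := id) (v := 1 : R) x1 (is_derive_id x 1).
  apply: (is_derive_eq (is_deriveM (is_derive_cst e x 1) dV)).
  by rewrite /GRing.scale/=; field.
rewrite (@ge0_substitution_decreasing R _ _ (fun s => expR (- s)) Rpos dF).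
- apply: eq_integral => x; rewrite inE RposE => x0; congr (_%:E).
  rewrite /mix_density opprK mul0r oppr0 expR0 mulr1; ring.
- by move=> x x0; rewrite oppr_lt0 divr_gt0// exprn_gt0.
- move=> x x0; apply: cvgN; apply: cvgM; first exact: cvg_cst.
  apply: (@continuous_comp _ _ _ (fun a : R => a ^+ 2) GRing.inv).
    exact: exprn_continuous.
  by apply: inv_continuous; rewrite expf_neq0// gt_eqF.
- by move=> x x0; rewrite RposE divr_gt0.
- move=> y; rewrite RposE => y0; exists (e / y); first by rewrite divr_gt0.
  by field; rewrite !gt_eqF.
- move=> y _; apply: (cvg_comp _ expR); last exact: continuous_expR.
  exact: opp_continuous.
- by move=> y _; exact: expR_ge0.
Qed.

(** With a0 = al / be, the points a = a0 exp u and a = a0 exp(- u) sweep ]a0, +oo[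
    and ]0, a0[ as u runs over ]0, +oo[, and al^2 / a + be^2 a = 2 al be cosh u at
    both. There a^-2 da is a multiple of exp(- u) du and of exp u du respectively, and
    the two add up to the factor cosh u of the Bessel integral of order 1. *)
Lemma besselK1_mix (al be : R) : 0 < al -> 0 < be ->
  2 * al * be * besselK 1 (2 * al * be) = al ^+ 2 * mix 2 (be ^+ 2) (al ^+ 2).
Proof.
move=> al0 be0; set z := 2 * al * be.
have z0 : 0 < z by rewrite !mulr_gt0.
pose a0 := al / be; have a00 : 0 < a0 by rewrite divr_gt0.
have al1 : al != 0 by rewrite gt_eqF.
have be1 : be != 0 by rewrite gt_eqF.
pose G a := al ^+ 2 * mix_density 2 (be ^+ 2) (al ^+ 2) a.
have G0 a : 0 < a -> 0 <= G a by move=> ?; rewrite mulr_ge0 ?sqr_ge0 ?mix_density_ge0.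
have cG (a : R) : 0 < a -> {for a, continuous G}.
  by move=> ?; apply: cvgM; [exact: cvg_cst|exact: continuous_mix_density].
have intG : mu.-integrable Rpos (EFin \o G).
  have : mu.-integrable Rpos (fun x => (al ^+ 2)%:E * (mix_density 2 (be ^+ 2) (al ^+ 2) x)%:E)%E.
    apply: integrableZl => //; apply: integrable_mix_density; first exact: sqr_ge0.
    by rewrite exprn_gt0.
  by apply: eq_integrable => // x _.
pose A u := al * be * expR u * expR (- z * coshR u).
pose B u := al * be * expR (- u) * expR (- z * coshR u).
have expo (u x : R) : x = a0 * expR u ->
    expR (- (al ^+ 2 / x)) * expR (- (be ^+ 2 * x)) = expR (- z * coshR u).
  move=> ->; rewrite -expRD; congr expR; rewrite /coshR expRN /a0 /z.
  by field; rewrite al1 be1 gt_eqF// expR_gt0.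
have cexpR (u : R) : {for u, continuous (fun u : R => a0 * expR u)}.
  by apply: cvgM; [exact: cvg_cst|exact: continuous_expR].
have cexpRN (u : R) : {for u, continuous (fun u : R => a0 * expR (- u))}.
  apply: cvgM; first exact: cvg_cst.
  by apply: (cvg_comp _ expR); [exact: opp_continuous|exact: continuous_expR].
have eA : (\int[mu]_(a in `]0%R, a0[) (G a)%:E = \int[mu]_(u in Rpos) (A u)%:E)%E.
  have dF (u : R) : 0 < u -> is_derive u 1 (fun u => a0 * expR (- u)) (- (a0 * expR (- u))).
    by move=> _; apply: is_derive_eq; rewrite /GRing.scale/=; ring.
  rewrite (@ge0_substitution_decreasing R _ _ G _ dF)//.
  - apply: eq_integral => u _; congr (_%:E); rewrite opprK /G /mix_density (expo (- u))//.
    rewrite /A (_ : coshR (- u) = coshR u); last by rewrite /coshR opprK addrC.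
    by rewrite expRN /a0; field; rewrite al1 be1 gt_eqF// expR_gt0.
  - by move=> u _; rewrite oppr_lt0 mulr_gt0// expR_gt0.
  - by move=> u _; apply: cvgN; exact: cexpRN.
  - move=> u u0; rewrite /= in_itv/= mulr_gt0 ?expR_gt0//=.
    by rewrite gtr_pMr// -expR0 ltr_expR oppr_lt0.
  - move=> y; rewrite /= in_itv/= => /andP[y0 y1]; exists (ln (a0 / y)).
      by rewrite ln_gt0// ltr_pdivlMr// mul1r.
    rewrite -lnV ?posrE ?divr_gt0// lnK ?posrE ?invr_gt0 ?divr_gt0//.
    by field; rewrite !gt_eqF.
  - by move=> y; rewrite /= in_itv/= => /andP[y0 _]; exact: cG.
  - by move=> y; rewrite /= in_itv/= => /andP[y0 _]; exact: G0.
have eB : (\int[mu]_(a in `]a0, +oo[) (G a)%:E = \int[mu]_(u in Rpos) (B u)%:E)%E.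
  have dF (u : R) : 0 < u -> is_derive u 1 (fun u => a0 * expR u) (a0 * expR u).
    by move=> _; apply: is_derive_eq; rewrite /GRing.scale/=; ring.
  rewrite (@ge0_substitution_increasing R _ _ G _ dF)//.
  - apply: eq_integral => u _; congr (_%:E); rewrite /G /mix_density (expo u)//.
    by rewrite /B expRN /a0; field; rewrite al1 be1 gt_eqF// expR_gt0.
  - by move=> u _; rewrite mulr_gt0// expR_gt0.
  - move=> u u0; rewrite /= in_itv/= andbT.
    by rewrite ltr_pMr// -expR0 ltr_expR.
  - move=> y; rewrite /= in_itv/= andbT => y1; exists (ln (y / a0)).
      by rewrite ln_gt0// ltr_pdivlMr// mul1r.
    rewrite lnK ?posrE ?divr_gt0// ?(lt_trans a00)//.
    by field; rewrite !gt_eqF.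
  - by move=> y; rewrite /= in_itv/= andbT => y1; apply/cG/(lt_trans a00).
  - by move=> y; rewrite /= in_itv/= andbT => y1; apply/G0/(lt_trans a00).
have ccosh (u : R) : {for u, continuous (fun u : R => expR (- z * coshR u))}.
  apply: (cvg_comp _ expR); last exact: continuous_expR.
  apply: cvgM; first exact: cvg_cst.
  apply: cvgM; last exact: cvg_cst.
  apply: cvgD; first exact: continuous_expR.
  by apply: (cvg_comp _ expR); [exact: opp_continuous|exact: continuous_expR].
have cA u : 0 < u -> {for u, continuous A}.
  move=> _; apply: cvgM; last exact: ccosh.
  by apply: cvgM; [exact: cvg_cst|exact: continuous_expR].
have cB u : 0 < u -> {for u, continuous B}.
  move=> _; apply: cvgM; last exact: ccosh.
  apply: cvgM; first exact: cvg_cst.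
  by apply: (cvg_comp _ expR); [exact: opp_continuous|exact: continuous_expR].
have split : (\int[mu]_(a in Rpos) (G a)%:E =
    \int[mu]_(a in `]0%R, a0[) (G a)%:E + \int[mu]_(a in `]a0, +oo[) (G a)%:E)%E.
  rewrite [X in (_ + X)%E]integral_itv_obnd_cbnd; last first.
    apply/measurable_EFinP; apply: measurable_funS (measurable_pos cG) => //.
    by move=> x; rewrite RposE /= in_itv/= andbT; exact: lt_trans.
  rewrite -ge0_integral_setU//=.
  - by rewrite -itv_bndbnd_setU// bnd_simp// ltW.
  - rewrite -itv_bndbnd_setU ?bnd_simp// ?ltW//.
    by apply/measurable_EFinP; exact: measurable_pos.
  - move=> x; rewrite !in_itv/= andbT lee_fin => -[/andP[x0 _]|x0]; first exact: G0.
    by apply: G0; apply: lt_le_trans x0.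
  - apply/disj_setPLR => x /=; rewrite !in_itv/= andbT => /andP[_ xa] ax.
    by move: xa; rewrite ltNge ax.
have key : (\int[mu]_(u in Rpos) (expR (- z * coshR u) * coshR (1 * u))%:E =
    (z^-1)%:E * \int[mu]_(a in Rpos) (G a)%:E)%E.
  rewrite split eA eB -ge0_integralD//.
  - rewrite -ge0_integralZl_EFin//.
    + apply: eq_integral => u _; rewrite -EFinD -EFinM; congr (_%:E).
      rewrite mul1r /A /B {2}/coshR /z; field; exact/andP.
    + move=> u _; rewrite -EFinD lee_fin addr_ge0// !mulr_ge0 ?expR_ge0// ltW//.
    + by apply/measurable_EFinP; apply: measurable_funD; exact: measurable_pos.
    + by rewrite invr_ge0 ltW.
  - by move=> u _; rewrite lee_fin !mulr_ge0 ?expR_ge0// ltW.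
  - by apply/measurable_EFinP; exact: measurable_pos.
  - by move=> u _; rewrite lee_fin !mulr_ge0 ?expR_ge0// ltW.
  - by apply/measurable_EFinP; exact: measurable_pos.
rewrite /besselK /Rintegral key fineM//; last exact: integrable_fin_num.
rewrite mulrA mulfV ?gt_eqF// mul1r /mix -RintegralZl//.
by apply: integrable_mix_density; [exact: sqr_ge0|rewrite exprn_gt0].
Qed.

Lemma matern1_mix (th d : R) : 0 < th -> 0 <= d ->
  matern 1 (d / th) = th ^- 2 * mix 2 (d ^+ 2) (th ^- 2).
Proof.
move=> th0; rewrite le_eqVlt => /predU1P[<-|d0].
  by rewrite mul0r /matern eqxx expr0n/= mix_diag// invr_gt0 exprn_gt0.
rewrite -exprVn -besselK1_mix ?invr_gt0// /matern mulf_eq0 invr_eq0 !gt_eqF//=.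
rewrite gammaR1 invr1 subrr powRr0 !mul1r powRr1; last first.
  by rewrite !mulr_ge0 ?sqrtr_ge0// ?invr_ge0 ltW.
rewrite sqrtr1 mulr1.
have -> : 2 * (d / th) = 2 * th^-1 * d by ring.
by [].
Qed.
End MaternMixture.

(** * Gaussian quadratic forms *)

Section KernelForms.
Context {R : realType}.
Notation mu := (@lebesgue_measure R).
Notation Rpos := (`]0%R, +oo[%classic : set R).

Lemma cvg_sumR (I T : Type) (F : set_system T) {FF : Filter F} (s : seq I) (P : pred I)
    (f : I -> T -> R) (l : I -> R) : (forall i, P i -> f i x @[x --> F] --> l i) ->
  \sum_(i <- s | P i) f i x @[x --> F] --> \sum_(i <- s | P i) l i.
Proof. by move=> fl; apply: cvg_big => //; exact: add_continuous. Qed.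

Lemma cvg_prodR (I T : Type) (F : set_system T) {FF : Filter F} (s : seq I) (P : pred I)
    (f : I -> T -> R) (l : I -> R) : (forall i, P i -> f i x @[x --> F] --> l i) ->
  \prod_(i <- s | P i) f i x @[x --> F] --> \prod_(i <- s | P i) l i.
Proof. by move=> fl; apply: cvg_big => //; exact: mul_continuous. Qed.

Definition sqdist n r (X : 'M[R]_(n, r)) (i j : 'I_n) : R :=
  enorm (row i X - row j X) ^+ 2.

Lemma sqdistE n r (X : 'M[R]_(n, r)) i j :
  sqdist X i j = \sum_k (X i k - X j k) ^+ 2.
Proof.
rewrite /sqdist /enorm sqr_sqrtr; last by apply: sumr_ge0 => k _; exact: sqr_ge0.
by apply: eq_bigr => k _; rewrite !mxE.
Qed.

Lemma sqdist_ge0 n r (X : 'M[R]_(n, r)) i j : 0 <= sqdist X i j.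
Proof. exact: sqr_ge0. Qed.

Lemma sqdistC n r (X : 'M[R]_(n, r)) i j : sqdist X i j = sqdist X j i.
Proof.
by rewrite !sqdistE; apply: eq_bigr => k _; rewrite -sqrrN opprB.
Qed.

Lemma sqdistii n r (X : 'M[R]_(n, r)) i : sqdist X i i = 0.
Proof. by rewrite sqdistE big1// => k _; rewrite subrr expr0n. Qed.

Lemma sqdist_gt0 n r (X : 'M[R]_(n, r)) i j :
  injective (fun i => row i X) -> i != j -> 0 < sqdist X i j.
Proof.
move=> injX ij; rewrite lt_def sqdist_ge0 andbT sqdistE.
apply: contra_neq ij => /psumr_eq0P h; apply: injX; apply/rowP => k; rewrite !mxE.
by apply/eqP; rewrite -subr_eq0 -sqrf_eq0 h// => l _; exact: sqr_ge0.
Qed.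

(** A factor x_i . x_j is a sum over l of x_il x_jl, which the weights w absorb. *)
Lemma dotprod_pow_psd n r (X : 'M[R]_(n, r)) k (w : 'I_n -> R) :
  0 <= \sum_i \sum_j w i * w j * (\sum_l X i l * X j l) ^+ k.
Proof.
elim: k w => [|k IH] w.
  rewrite (_ : \sum_i _ = (\sum_i w i) ^+ 2) ?sqr_ge0// expr2 [RHS]mulr_suml.
  apply: eq_bigr => i _; rewrite mulr_sumr; apply: eq_bigr => j _.
  by rewrite expr0 mulr1.
have -> : \sum_i \sum_j w i * w j * (\sum_l X i l * X j l) ^+ k.+1 =
   \sum_l \sum_i \sum_j (w i * X i l) * (w j * X j l) * (\sum_l X i l * X j l) ^+ k.
  rewrite [RHS]exchange_big/=; apply: eq_bigr => i _.
  rewrite [RHS]exchange_big/=; apply: eq_bigr => j _.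
  rewrite exprS mulrA mulr_sumr mulr_suml; apply: eq_bigr => l _; ring.
by apply: sumr_ge0 => l _; exact: IH.
Qed.

(** Limit of the partial sums of the exponential series, whose terms are
    [dotprod_pow_psd]. *)
Lemma exp_dotprod_psd n r (X : 'M[R]_(n, r)) (t : R) (w : 'I_n -> R) : 0 <= t ->
  0 <= \sum_i \sum_j w i * w j * expR (t * \sum_l X i l * X j l).
Proof.
move=> t0.
pose D i j := \sum_l X i l * X j l.
have cv : \sum_i \sum_j w i * w j * series (exp_coeff (t * D i j)) N @[N --> \oo] -->
    \sum_i \sum_j w i * w j * expR (t * D i j).
  apply: cvg_sumR => i _; apply: cvg_sumR => j _; apply: cvgM; first exact: cvg_cst.
  exact: is_cvg_series_exp_coeff.
rewrite -(cvg_lim _ cv)//; apply: limr_ge; first by apply/cvg_ex; eexists; exact: cv.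
apply: nearW => N.
have -> : \sum_i \sum_j w i * w j * series (exp_coeff (t * D i j)) N =
    \sum_(0 <= k < N) t ^+ k / k`!%:R * \sum_i \sum_j w i * w j * D i j ^+ k.
  under [RHS]eq_bigr do rewrite mulr_sumr.
  rewrite [RHS]exchange_big/=; apply: eq_bigr => i _.
  under [RHS]eq_bigr do rewrite mulr_sumr.
  rewrite [RHS]exchange_big/=; apply: eq_bigr => j _.
  rewrite /series/= mulr_sumr; apply: eq_bigr => k _.
  rewrite /exp_coeff/= exprMn; ring.
apply: sumr_ge0 => k _; rewrite mulr_ge0 ?dotprod_pow_psd//.
by rewrite divr_ge0// exprn_ge0.
Qed.

(** The matrix B stands for v v^T, and for products of two different contrasts. *)
Definition gauss_form n r (X : 'M[R]_(n, r)) (B : 'M[R]_n) (a : R) : R :=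
  \sum_i \sum_j B i j * expR (- (sqdist X i j * a)).

(** exp(- a |x - y|^2) = exp(- a |x|^2) exp(- a |y|^2) exp(2 a x.y), where the first
    two factors are absorbed by the weights. *)
Lemma gauss_form_psd n r (X : 'M[R]_(n, r)) (v : 'cV[R]_n) a : 0 <= a ->
  0 <= gauss_form X (v *m v^T) a.
Proof.
move=> a0.
pose w i := v i 0 * expR (- (a * \sum_l X i l ^+ 2)).
rewrite /gauss_form (_ : \sum_i _ =
    \sum_i \sum_j w i * w j * expR ((2 * a) * \sum_l X i l * X j l)).
  by apply: exp_dotprod_psd; rewrite mulr_ge0.
apply: eq_bigr => i _; apply: eq_bigr => j _.
rewrite !mxE big_ord1 mxE /w sqdistE.
have -> : - ((\sum_k (X i k - X j k) ^+ 2) * a) = - (a * \sum_l X i l ^+ 2) +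
   - (a * \sum_l X j l ^+ 2) + 2 * a * \sum_l X i l * X j l.
  rewrite mulr_suml !mulr_sumr -!sumrN -!big_split/=; apply: eq_bigr => k _; ring.
rewrite !expRD; ring.
Qed.

Lemma continuous_gauss_form n r (X : 'M[R]_(n, r)) B : continuous (gauss_form X B).
Proof.
move=> a; apply: cvg_sumR => i _; apply: cvg_sumR => j _; apply: cvgM; first exact: cvg_cst.
apply: (cvg_comp _ expR); last exact: continuous_expR.
by apply: cvgN; apply: cvgM; [exact: cvg_cst|exact: cvg_id].
Qed.

(** Distinct points decouple at large a, so that the form tends to |v|^2. *)
Lemma gauss_form_gt0 n r (X : 'M[R]_(n, r)) (v : 'cV[R]_n) :
  injective (fun i => row i X) -> v != 0 -> exists2 a : R, 0 < a & 0 < gauss_form X (v *m v^T) a.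
Proof.
move=> injX v0.
have v2 : 0 < \sum_i v i 0 ^+ 2.
  rewrite lt_def sumr_ge0 ?andbT => [|i _]; last exact: sqr_ge0.
  apply: contra_neq v0 => /psumr_eq0P h; apply/matrixP => i j; rewrite ord1 mxE.
  by apply/eqP; rewrite -sqrf_eq0 h// => k _; exact: sqr_ge0.
have cv : gauss_form X (v *m v^T) a @[a --> +oo] --> \sum_i v i 0 ^+ 2.
  apply: cvg_sumR => i _.
  rewrite [v i 0 ^+ 2](_ : _ = \sum_j (v *m v^T) i j * (i == j)%:R); last first.
    rewrite (bigD1 i)//= big1 ?addr0 => [|j ji].
      by rewrite eqxx mulr1 !mxE big_ord1 mxE expr2.
    by rewrite eq_sym (negbTE ji) mulr0.
  apply: cvg_sumR => j _; apply: cvgM; first exact: cvg_cst.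
  have [->|ij] := eqVneq i j.
    under eq_fun do rewrite sqdistii mul0r oppr0 expR0; exact: cvg_cst.
  apply: (@cvg_comp _ _ _ (fun a => sqdist X i j * a) (fun a => expR (- a)) _ (pinfty_nbhs R)).
    by apply: gt0_cvgMry; [exact: sqdist_gt0|exact: cvg_id].
  exact: cvgr_expR.
have h : \forall a \near +oo, 0 < a /\ 0 < gauss_form X (v *m v^T) a.
  near=> a; split; first by near: a; exact: nbhs_pinfty_gt.
  by near: a; exact: (cvgr_gt _ cv).
by have [a [a0 qa]] := filter_ex h; exists a.
Unshelve. all: by end_near. Qed.

Lemma expRN_taylor (x : R) : 0 <= x -> `|expR (- x) - 1 + x| <= x ^+ 2.
Proof.
move=> x0; have x1 : 0 < 1 + x by rewrite ltr_wpDr.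
have h1 := expR_ge1Dx (- x); have h2 := expR_ge1Dx x.
have : expR (- x) <= (1 + x)^-1 by rewrite expRN lef_pV2 ?posrE ?expR_gt0.
(* (1 + x) (1 - x + x^2) = 1 + x^3 *)
have h4 : (1 + x)^-1 <= 1 - x + x ^+ 2.
  rewrite -[leLHS]mul1r ler_pdivrMr//.
  have : 0 <= x ^+ 3 by rewrite exprn_ge0.
  by rewrite !exprS expr0; nra.
move=> h3; rewrite ler_norml; apply/andP; split; last by lra.
by have := sqr_ge0 x; lra.
Qed.

Definition gauss_form_bound n r (X : 'M[R]_(n, r)) (B : 'M[R]_n) : R :=
  \sum_i \sum_j `|B i j| * (1 + sqdist X i j ^+ 2).

Lemma gauss_form_bound_ge0 n r (X : 'M[R]_(n, r)) B : 0 <= gauss_form_bound X B.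
Proof.
by apply: sumr_ge0 => i _; apply: sumr_ge0 => j _; rewrite mulr_ge0// addr_ge0 ?sqr_ge0.
Qed.

(** Cancellation of the terms of order 0 and 1 makes the form O(a^2); it is also
    bounded, whence the factor a^2 / (1 + a^2). *)
Lemma gauss_form_le n r (X : 'M[R]_(n, r)) (B : 'M[R]_n) a :
  \sum_i \sum_j B i j = 0 -> \sum_i \sum_j B i j * sqdist X i j = 0 -> 0 < a ->
  `|gauss_form X B a| <= gauss_form_bound X B * a ^+ 2 / (1 + a ^+ 2).
Proof.
move=> B0 B1 a0.
have a20 : 0 < 1 + a ^+ 2 by rewrite ltr_wpDr ?sqr_ge0.
have M1 : `|gauss_form X B a| <= \sum_i \sum_j `|B i j|.
  apply: le_trans (ler_norm_sum _ _ _) _; apply: ler_sum => i _.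
  apply: le_trans (ler_norm_sum _ _ _) _; apply: ler_sum => j _.
  rewrite normrM ler_piMr// ger0_norm ?expR_ge0// -expR0 ler_expR oppr_le0.
  by rewrite mulr_ge0 ?sqdist_ge0// ltW.
have M2 : `|gauss_form X B a| <= a ^+ 2 * \sum_i \sum_j `|B i j| * sqdist X i j ^+ 2.
  have -> : gauss_form X B a =
     \sum_i \sum_j B i j * (expR (- (sqdist X i j * a)) - 1 + sqdist X i j * a).
    transitivity (gauss_form X B a - \sum_i \sum_j B i j +
        (\sum_i \sum_j B i j * sqdist X i j) * a); first by rewrite B0 B1; ring.
    rewrite /gauss_form mulr_suml -sumrB -big_split/=; apply: eq_bigr => i _.
    rewrite mulr_suml -sumrB -big_split/=; apply: eq_bigr => j _; ring.
  rewrite mulr_sumr; apply: le_trans (ler_norm_sum _ _ _) _; apply: ler_sum => i _.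
  rewrite mulr_sumr; apply: le_trans (ler_norm_sum _ _ _) _; apply: ler_sum => j _.
  rewrite normrM mulrCA -exprMn [a * _]mulrC ler_wpM2l// expRN_taylor//.
  by rewrite mulr_ge0 ?sqdist_ge0// ltW.
have -> : gauss_form_bound X B =
    \sum_i \sum_j `|B i j| + \sum_i \sum_j `|B i j| * sqdist X i j ^+ 2.
  rewrite -big_split/=; apply: eq_bigr => i _; rewrite -big_split/=.
  by apply: eq_bigr => j _; rewrite mulrDr mulr1.
rewrite ler_pdivlMr// mulrDr mulr1 mulrDl addrC lerD//.
  by rewrite ler_wpM2r ?sqr_ge0.
by rewrite mulrC.
Qed.

End KernelForms.

(** * Mixtures of Gaussian forms *)

Section MixedForms.
Context {R : realType}.
Notation mu := (@lebesgue_measure R).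
Notation Rpos := (`]0%R, +oo[%classic : set R).

Lemma Rintegral_lincomb (I : eqType) (s : seq I) (b : I -> R) (f : I -> R -> R) :
  (forall i, mu.-integrable Rpos (EFin \o f i)) ->
  \int[mu]_(a in Rpos) (\sum_(i <- s) b i * f i a) =
  \sum_(i <- s) b i * \int[mu]_(a in Rpos) f i a.
Proof.
move=> intf.
have intZ i : mu.-integrable Rpos (EFin \o (fun a => b i * f i a)).
  have : mu.-integrable Rpos (fun x => (b i)%:E * (f i x)%:E)%E.
    by apply: integrableZl => //; exact: intf.
  by apply: eq_integrable => // x _.
suff [] : mu.-integrable Rpos (EFin \o (fun a => \sum_(i <- s) b i * f i a)) /\
  \int[mu]_(a in Rpos) (\sum_(i <- s) b i * f i a) =
  \sum_(i <- s) b i * \int[mu]_(a in Rpos) f i a by [].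
elim: s => [|i s [IH1 IH2]].
  have E : (fun a => \sum_(i <- [::]) b i * f i a) = cst 0.
    by apply/funext => a; rewrite big_nil.
  by rewrite E big_nil /Rintegral integral0; split => //; exact: integrable0.
have E : (fun a => \sum_(j <- i :: s) b j * f j a) =
    (fun a => b i * f i a + \sum_(j <- s) b j * f j a).
  by apply/funext => a; rewrite big_cons.
rewrite E big_cons -IH2 RintegralD// -RintegralZl//; split => //.
have : mu.-integrable Rpos (fun a => (b i * f i a)%:E + (\sum_(j <- s) b j * f j a)%:E)%E.
  by apply: integrableD => //; exact: intZ.
by apply: eq_integrable => // x _.
Qed.

Lemma mix_densityE k c e (a : R) : mix_density k c e a = expR (- (c * a)) * mix_density k 0 e a.
Proof. by rewrite /mix_density mul0r oppr0 expR0 mulr1 mulrA [expR (- (c * a)) * _]mulrC. Qed.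

Context (n r : nat) (X : 'M[R]_(n, r)).

Lemma sum_mix k (B : 'M[R]_n) (e : R) : 0 < e ->
  \sum_i \sum_j B i j * mix k.+2 (sqdist X i j) e =
  \int[mu]_(a in Rpos) (gauss_form X B a * mix_density k.+2 0 e a).
Proof.
move=> e0; rewrite pair_big/= /mix -Rintegral_lincomb/=; last first.
  by move=> i; apply: integrable_mix_density => //; exact: sqdist_ge0.
apply: eq_Rintegral => a _; rewrite /gauss_form pair_big/= mulr_suml.
by apply: eq_bigr => p _; rewrite mix_densityE mulrA.
Qed.

Definition mix_mx k (e : R) : 'M[R]_n := \matrix_(i, j) mix k (sqdist X i j) e.

Lemma cont_gauss_form_mix_density k B (e a : R) : 0 < a ->
  {for a, continuous (fun a => gauss_form X B a * mix_density k 0 e a)}.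
Proof.
by move=> a0; apply: cvgM; [exact: continuous_gauss_form|exact: continuous_mix_density].
Qed.

Lemma integrable_gauss_form_mix_density k B (e : R) : 0 < e ->
  mu.-integrable Rpos (EFin \o (fun a => gauss_form X B a * mix_density k.+2 0 e a)).
Proof.
move=> e0; have Mb : forall a, 0 < a -> `|gauss_form X B a| <= \sum_i \sum_j `|B i j|.
  move=> a a0; apply: le_trans (ler_norm_sum _ _ _) _; apply: ler_sum => i _.
  apply: le_trans (ler_norm_sum _ _ _) _; apply: ler_sum => j _.
  rewrite normrM ler_piMr// ger0_norm ?expR_ge0// -expR0 ler_expR oppr_le0.
  by rewrite mulr_ge0 ?sqdist_ge0// ltW.
apply: (@integrable_pos _ _ ((\sum_i \sum_j `|B i j|) * mix_density_bound k e)).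
  by move=> x x0; exact: cont_gauss_form_mix_density.
by move=> x x0; rewrite normrM -mulrA ler_pM// ?Mb// mix_density_le.
Qed.

Lemma mix_mx_posdef k (e : R) : injective (fun i => row i X) -> 0 < e ->
  posdef (mix_mx k.+2 e).
Proof.
move=> injX e0; split.
  by apply/matrixP => i j; rewrite mxE [LHS]mxE [RHS]mxE sqdistC.
move=> v v0.
have -> : qform (mix_mx k.+2 e) v =
    \sum_i \sum_j (v *m v^T) i j * mix k.+2 (sqdist X i j) e.
  rewrite qformE; apply: eq_bigr => i _; apply: eq_bigr => j _.
  by rewrite !mxE big_ord1 mxE.
rewrite sum_mix//; have [a a0 qa] := gauss_form_gt0 injX v0.
apply: (@Rintegral_pos_gt0 _ _ a) => //.
- by move=> x x0; exact: cont_gauss_form_mix_density.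
- exact: integrable_gauss_form_mix_density.
- by move=> x x0; rewrite mulr_ge0 ?mix_density_ge0// gauss_form_psd// ltW.
- by rewrite mulr_gt0// /mix_density !mulr_gt0 ?expR_gt0// invr_gt0 exprn_gt0.
Qed.

(** The antiderivative ln((a + e) / (a + 1)) vanishes at infinity. *)
Lemma integral_log (e : R) : 0 < e -> e <= 1 ->
  (\int[mu]_(a in Rpos) ((a + e)^-1 - (a + 1)^-1)%:E = (ln e^-1)%:E)%E.
Proof.
move=> e0 e1.
have dln (c a : R) : 0 < c -> 0 <= a -> is_derive a 1 (fun a => ln (a + c)) (a + c)^-1.
  move=> c0 a0; have ac : 0 < a + c by rewrite ltr_wpDl.
  have h := is_derive1_ln ac.
  have h2 : is_derive a 1 (fun a : R => a + c) 1.
    by apply: is_derive_eq; rewrite addr0.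
  by have := @is_derive1_comp _ (@ln R) (fun a => a + c) a _ _ h h2; rewrite mulr1.
have dF (a : R) : 0 <= a -> is_derive a 1
    (fun a => ln (a + e) - ln (a + 1)) ((a + e)^-1 - (a + 1)^-1).
  by move=> a0; apply: is_deriveB; apply: dln.
have cV (c a : R) : 0 < c -> 0 <= a -> {for a, continuous (fun a : R => (a + c)^-1)}.
  move=> c0 a0; apply: (@continuous_comp _ _ _ (fun a : R => a + c) GRing.inv).
    by apply: cvgD; [exact: cvg_id|exact: cvg_cst].
  by apply: inv_continuous; rewrite gt_eqF// ltr_wpDl.
have cf (a : R) : 0 <= a -> {for a, continuous (fun a : R => (a + e)^-1 - (a + 1)^-1)}.
  by move=> a0; apply: cvgB; apply: cV.
rewrite integral_itv_obnd_cbnd; last first.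
  by apply/measurable_EFinP; apply: measurable_pos => x /ltW; exact: cf.
rewrite (@ge0_continuous_FTC2y _ _ (fun a => ln (a + e) - ln (a + 1)) _ 0).
- by rewrite -EFinB !add0r ln1 subr0 lnV ?posrE.
- by move=> x x0; rewrite subr_ge0 lef_pV2 ?posrE ?ltr_wpDl// lerD2l.
- apply: continuous_in_subspaceT => x; rewrite inE/= in_itv/= andbT; exact: cf.
- have V0 : (x^-1 : R) @[x --> +oo] --> 0.
    apply/cvgrPdist_lt => d d0; near=> x; have x0 : 0 < x by near: x; exact: nbhs_pinfty_gt.
    rewrite sub0r normrN ger0_norm ?invr_ge0 ?(ltW x0)// -[d]invrK ltf_pV2 ?posrE ?invr_gt0//.
    by near: x; apply: nbhs_pinfty_gt; rewrite num_real.
  apply: (@squeeze_cvgr _ _ _ _ (fun x => - x^-1) (cst 0)); last 2 first.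
  - by rewrite -oppr0; apply: cvgN.
  - exact: cvg_cst.
  near=> x; have x0 : 0 < x by near: x; exact: nbhs_pinfty_gt.
  have xe : 0 < x + e by rewrite addr_gt0.
  have x1 : 0 < x + 1 by rewrite addr_gt0.
  rewrite subr_le0 ler_ln ?posrE// lerD2l e1 andbT lerNl opprB -ln_div ?posrE//.
  have -> : (x + 1) / (x + e) = 1 + (1 - e) / (x + e) by field; rewrite gt_eqF.
  apply: (le_trans (le_ln1Dx _)).
    by apply: lt_le_trans (_ : 0 <= _); rewrite ?ltrN10// divr_ge0 ?subr_ge0// ltW.
  rewrite -[leRHS]mul1r ler_pM ?subr_ge0 ?invr_ge0 ?(ltW xe)//.
    by rewrite lerBlDr lerDl ltW.
  by rewrite lef_pV2 ?posrE// lerDl ltW.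
- by move=> x /ltW x0; have [] := dF x x0.
- have [/derivable1_diffP/differentiable_continuous h _] := dF 0 (lexx _).
  exact: cvg_at_right_filter.
- move=> x; rewrite in_itv/= andbT => /ltW x0; rewrite derive1E.
  by have [] := dF x x0.
Unshelve. all: by end_near. Qed.

Section Cancellation.
Context (B : 'M[R]_n).
Hypotheses (B0 : \sum_i \sum_j B i j = 0)
  (B1 : \sum_i \sum_j B i j * sqdist X i j = 0).

(** The integrand is O(exp(- e / a) / (a (1 + a^2))). Since
    exp(- x) <= 1 / (1 + x), the quotient exp(- e / a) / a is at most 1 / (a + e);
    for e <= 1 / 2, 1 / ((a + e) (1 + a^2)) is at most
    4 (1 / (a + e) - 1 / (a + 1)), whose integral is [integral_log]. *)
Lemma sum_mix3_le (e : R) : 0 < e -> e <= 2^-1 ->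
  `|\sum_i \sum_j B i j * mix 3 (sqdist X i j) e| <= 4 * gauss_form_bound X B * ln e^-1.
Proof.
move=> e0 e1; rewrite sum_mix//.
have intf := @integrable_gauss_form_mix_density 1 B e e0.
have elt1 : e <= 1 by lra.
apply: le_trans (le_normr_Rintegral _ intf) _ => //.
pose g a := 4 * gauss_form_bound X B * ((a + e)^-1 - (a + 1)^-1).
have g0 a : 0 < a -> 0 <= (a + e)^-1 - (a + 1)^-1.
  by move=> a0; rewrite subr_ge0 lef_pV2 ?posrE ?addr_gt0// lerD2l.
have C0 : 0 <= 4 * gauss_form_bound X B by rewrite mulr_ge0 ?gauss_form_bound_ge0.
have cV (c a : R) : 0 < c -> 0 < a -> {for a, continuous (fun a : R => (a + c)^-1)}.
  move=> c0 a0; apply: (@continuous_comp _ _ _ (fun a : R => a + c) GRing.inv).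
    by apply: cvgD; [exact: cvg_id|exact: cvg_cst].
  by apply: inv_continuous; rewrite gt_eqF// addr_gt0.
have mg : measurable_fun Rpos (fun a : R => (a + e)^-1 - (a + 1)^-1).
  by apply: measurable_pos => a a0; apply: cvgB; exact: cV.
have ig : (\int[mu]_(a in Rpos) (g a)%:E = (4 * gauss_form_bound X B * ln e^-1)%:E)%E.
  rewrite [RHS]EFinM -integral_log// -ge0_integralZl_EFin//.
    by move=> a; rewrite RposE lee_fin; exact: g0.
  exact/measurable_EFinP.
have intg : mu.-integrable Rpos (EFin \o g).
  apply/integrableP; split; first by apply/measurable_EFinP; apply: measurable_funM.
  have E : (\int[mu]_(a in Rpos) `|(EFin \o g) a| = \int[mu]_(a in Rpos) (g a)%:E)%E.
    apply: eq_integral => a; rewrite inE RposE => a0.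
    by rewrite /= ger0_norm// mulr_ge0 ?g0.
  by rewrite E ig ltry.
rewrite -[leRHS]/(fine (EFin _)) -ig; apply: le_Rintegral => //.
  exact: integrable_norm.
move=> a; rewrite RposE => a0.
have a20 : 0 < 1 + a ^+ 2 by rewrite ltr_wpDr ?sqr_ge0.
have ae : 0 < a + e by rewrite addr_gt0.
have an : a != 0 by rewrite gt_eqF.
rewrite normrM [`|mix_density _ _ _ _|]ger0_norm ?mix_density_ge0//.
apply: (@le_trans _ _ (gauss_form_bound X B * a ^+ 2 / (1 + a ^+ 2) * (a ^- 2 / (a + e)))).
  rewrite ler_pM ?mix_density_ge0 ?gauss_form_le// /mix_density mul0r oppr0 expR0 mulr1.
  rewrite expRN; have h := expR_ge1Dx (e / a).
  rewrite -invfM -[leRHS]invfM lef_pV2 ?posrE ?mulr_gt0 ?expR_gt0 ?exprn_gt0//.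
  rewrite [leRHS]mulrC [a ^+ 3]exprSr -[a ^+ 2 * a * _]mulrA ler_pM2l ?exprn_gt0//.
  apply: (@le_trans _ _ (a * (1 + e / a))); last by rewrite ler_pM2l.
  by rewrite mulrDr mulr1 mulrCA mulfV// mulr1.
rewrite /g (_ : _ * (a ^- 2 / (a + e)) =
  gauss_form_bound X B * ((1 + a ^+ 2)^-1 / (a + e))); last first.
  by field; rewrite an !gt_eqF.
rewrite [4 * _]mulrC -mulrA ler_wpM2l ?gauss_form_bound_ge0//.
have -> : 4 * ((a + e)^-1 - (a + 1)^-1) = (4 * (1 - e) / (a + 1)) / (a + e).
  by field; rewrite !gt_eqF// addr_gt0.
rewrite ler_pM2r ?invr_gt0// -[leLHS]mul1r ler_pdivrMr// mulrAC ler_pdivlMr ?addr_gt0//.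
(* 1 + a <= 2 (1 + a^2) *)
have h2 : 2 <= 4 * (1 - e) by lra.
rewrite mul1r (@le_trans _ _ (2 * (1 + a ^+ 2)))//; last by rewrite ler_pM2r.
by rewrite expr2; have := sqr_ge0 (a - 1); rewrite expr2; nra.
Qed.

Definition gauss_form_limit : R := \int[mu]_(a in Rpos) (gauss_form X B a * a ^- 2).

(** Each term diverges as e tends to 0; only the combination is dominated by an
    integrable function. Replacing e by its absolute value extends the integral
    to a neighbourhood of 0, where it is continuous. *)
Lemma cvg_sum_mix2 :
  \sum_i \sum_j B i j * mix 2 (sqdist X i j) e @[e --> 0^'+] --> gauss_form_limit.
Proof.
pose f (x a : R) := gauss_form X B a * mix_density 2 0 `|x| a.
have f_le (x a : R) : 0 < a -> `|f x a| <= gauss_form_bound X B / (1 + a ^+ 2).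
  move=> a0; have a20 : 0 < 1 + a ^+ 2 by rewrite ltr_wpDr ?sqr_ge0.
  rewrite normrM; apply: (@le_trans _ _ (gauss_form_bound X B * a ^+ 2 / (1 + a ^+ 2) * a ^- 2)).
    rewrite ler_pM ?gauss_form_le// ger0_norm ?mix_density_ge0// /mix_density mul0r.
    rewrite oppr0 expR0 mulr1 ler_piMl ?invr_ge0 ?exprn_ge0 ?(ltW a0)// -expR0 ler_expR oppr_le0.
    by rewrite divr_ge0// ltW.
  rewrite le_eqVlt; apply/orP; left; apply/eqP; field.
  by rewrite !gt_eqF.
have cfa (x a : R) : 0 < a -> {for a, continuous (f x)}.
  by move=> a0; exact: cont_gauss_form_mix_density.
have intf x : `]-1, 1[%classic x -> mu.-integrable Rpos (EFin \o f x).
  by move=> _; apply: (@integrable_pos _ _ (gauss_form_bound X B)) => a a0;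
    [exact: cfa|exact: f_le].
have cf : {ae mu, forall a : R, Rpos a -> {in (`]-1, 1[%classic : set R), continuous (f ^~ a)}}.
  apply: aeW => a _ x _; apply: cvgM; first exact: cvg_cst.
  apply: cvgM; last exact: cvg_cst.
  apply: cvgM; last exact: cvg_cst.
  apply: (cvg_comp _ expR); last exact: continuous_expR.
  apply: cvgN; apply: cvgM; last exact: cvg_cst.
  exact: norm_continuous.
have gub x : `]-1, 1[%classic x ->
    {ae mu, forall a : R, Rpos a -> `|f x a| <= gauss_form_bound X B / (1 + a ^+ 2)}.
  by move=> _; apply: aeW => a; rewrite RposE; exact: f_le.
have := continuity_under_integral _ intf cf (integrable_oneDsqrVZ _) gub.
move=> /(_ _ 0); rewrite inE/= in_itv/= ltrN10 ltr01 => /(_ _ isT) h.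
have e0 : \int[mu]_(a in Rpos) f 0 a = gauss_form_limit.
  apply: eq_Rintegral => a _.
  by rewrite /f /mix_density normr0 !mul0r oppr0 expR0 !mul1r.
have {}h : \int[mu]_(a in Rpos) f e a @[e --> (0 : R)] --> \int[mu]_(a in Rpos) f 0 a.
  by apply: h; exact: measurable_itv.
rewrite -e0; apply: cvg_trans (cvg_at_right_filter h).
apply: near_eq_cvg; near=> e.
have e1 : 0 < e by near: e; exact: nbhs_right_gt.
by rewrite sum_mix// /f ger0_norm// ltW.
Unshelve. all: by end_near. Qed.

End Cancellation.
End MixedForms.

(** * Entrywise limits, dispersion, bounds on the half-line *)

Section EntrywiseLimits.
Context {R : realType} {T : Type} (F : set_system T) {FF : Filter F}.

(** Entrywise convergence spares the topology on matrices, of which only sums and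
    products of entries are needed. *)
Definition mxcvg m n (A : T -> 'M[R]_(m, n)) (L : 'M[R]_(m, n)) : Prop :=
  forall i j, A t i j @[t --> F] --> L i j.

Lemma mxcvg_cst m n (L : 'M[R]_(m, n)) : mxcvg (fun=> L) L.
Proof. by move=> i j; exact: cvg_cst. Qed.

Lemma mxcvg_mul m n p (A : T -> 'M[R]_(m, n)) (B : T -> 'M[R]_(n, p)) A0 B0 :
  mxcvg A A0 -> mxcvg B B0 -> mxcvg (fun t => A t *m B t) (A0 *m B0).
Proof.
move=> cA cB i j; under eq_fun do rewrite mxE; rewrite mxE.
by apply: cvg_sumR => k _; apply: cvgM.
Qed.

Lemma cvg_mxtrace n (A : T -> 'M[R]_n) A0 :
  mxcvg A A0 -> \tr (A t) @[t --> F] --> \tr A0.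
Proof. by move=> cA; apply: cvg_sumR => i _; exact: cA. Qed.

Lemma cvg_det n (A : T -> 'M[R]_n) A0 :
  mxcvg A A0 -> \det (A t) @[t --> F] --> \det A0.
Proof.
move=> cA; apply: cvg_sumR => s _; apply: cvgM; first exact: cvg_cst.
by apply: cvg_prodR => i _; exact: cA.
Qed.

Lemma mxcvg_adj n (A : T -> 'M[R]_n) A0 :
  mxcvg A A0 -> mxcvg (fun t => \adj (A t)) (\adj A0).
Proof.
move=> cA i j; under eq_fun do rewrite mxE; rewrite mxE.
apply: cvgM; first exact: cvg_cst.
by apply: cvg_det => k l; under eq_fun do rewrite !mxE; rewrite !mxE; exact: cA.
Qed.

Lemma mxcvg_inv n (A : T -> 'M[R]_n) A0 : A0 \in unitmx ->
  mxcvg A A0 -> mxcvg (fun t => invmx (A t)) (invmx A0).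
Proof.
move=> uA cA i j; have dA0 : \det A0 != 0 by rewrite -unitfE -unitmxE.
have cdet := cvg_det cA.
have : ((\det (A t))^-1 * (\adj (A t)) i j) @[t --> F] --> invmx A0 i j.
  rewrite /invmx uA mxE; apply: cvgM; last exact: mxcvg_adj.
  exact: cvgV.
apply: cvg_trans; apply: near_eq_cvg.
have dn : \forall t \near F, \det (A t) != 0 := cvgr_neq0 _ cdet dA0.
near=> t; have dt : \det (A t) != 0 by near: t; exact: dn.
by rewrite /invmx unitmxE unitfE dt [RHS]mxE.
Unshelve. all: by end_near. Qed.

End EntrywiseLimits.

Section Dispersion.
Context {R : realType}.

(** m times the variance of the eigenvalues of A, counted with multiplicity. *)
Definition dispersion m (A : 'M[R]_m) : R :=
  \tr (A *m A) - m%:R^-1 * (\tr A) ^+ 2.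

(** A multiple of the identity shifts the spectrum, which leaves its variance
    unchanged. *)
Lemma dispersion_affine m (al be : R) (B : 'M[R]_m) : (0 < m)%N ->
  dispersion (al%:M + be *: B) = be ^+ 2 * dispersion B.
Proof.
move=> m0; rewrite /dispersion mulmxDl !mulmxDr !mul_scalar_mx !mul_mx_scalar.
rewrite -!scalemxAl -!scalemxAr !mxtraceD !mxtraceZ !mxtrace_scalar.
have m1 : m%:R != 0 :> R by rewrite pnatr_eq0 -lt0n.
rewrite -!(mulr_natr al); by field.
Qed.

Lemma dispersion_le m (A : 'M[R]_m) (c : R) : (forall i j, `|A i j| <= c) ->
  dispersion A <= (m%:R * c) ^+ 2.
Proof.
move=> Ac; rewrite /dispersion lerBlDr -[leLHS]addr0 lerD//; last first.
  by rewrite mulr_ge0 ?invr_ge0// sqr_ge0.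
apply: le_trans (ler_norm _) _; apply: le_trans (ler_norm_sum _ _ _) _.
rewrite exprMn expr2 -mulrA mulr_natl.
apply: (@le_trans _ _ (\sum_(i < m) (m%:R * c ^+ 2))); last first.
  by rewrite sumr_const card_ord.
apply: ler_sum => i _; rewrite mxE; apply: le_trans (ler_norm_sum _ _ _) _.
rewrite mulr_natl (_ : _ *+ m = \sum_(j < m) c ^+ 2); last first.
  by rewrite sumr_const card_ord.
by apply: ler_sum => j _; rewrite normrM expr2 ler_pM.
Qed.

Lemma cvg_dispersion (T : Type) (F : set_system T) {FF : Filter F} m
    (A : T -> 'M[R]_m) A0 :
  mxcvg F A A0 -> dispersion (A t) @[t --> F] --> dispersion A0.
Proof.
move=> cA; apply: cvgB; first by apply: cvg_mxtrace; exact: mxcvg_mul.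
apply: cvgM; first exact: cvg_cst.
by rewrite expr2; apply: cvgM; exact: cvg_mxtrace.
Qed.

Lemma derive1_mx m n (M : R -> 'M[R]_(m, n)) (t : R) (D : 'M[R]_(m, n)) :
  (forall i j, is_derive t 1 (fun t => M t i j) (D i j)) -> (M^`()%classic) t = D.
Proof.
move=> dM; rewrite derive1E derive_mx; last first.
  by apply/derivable_mxP => i j; have [] := dM i j.
by apply/matrixP => i j; rewrite mxE; have [] := dM i j.
Qed.

End Dispersion.

Section HalfLineBounds.
Context {R : realType}.
Notation mu := (@lebesgue_measure R).
Notation Rpos := (`]0%R, +oo[%classic : set R).

Lemma bounded_near0 (f : R -> R) (l t : R) :
  (forall x : R, 0 < x -> {for x, continuous f}) -> f x @[x --> 0^'+] --> l ->
  exists M : R, forall x : R, 0 < x -> x <= t -> `|f x| <= M.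
Proof.
move=> cf fl.
have /cvgrPdist_lt /(_ 1 ltr01) := fl; move=> [d /= d0 dP].
have near0 (x : R) : 0 < x -> x < d -> `|f x| <= `|l| + 1.
  move=> x0 xd; have : `|l - f x| < 1.
    by apply: dP => //; rewrite /= sub0r normrN gtr0_norm.
  move=> h; have -> : f x = l - (l - f x) by ring.
  by apply: le_trans (ler_normB _ _) _; rewrite lerD2l ltW.
have [td|dt] := ltP t d.
  by exists (`|l| + 1) => x x0 xt; apply: near0 => //; apply: le_lt_trans td.
have [|c _ cM] := @EVT_max R (fun x => `|f x|) d t dt.
  apply: continuous_in_subspaceT => x; rewrite inE/= in_itv/= => /andP[dx _].
  by apply: cvg_norm; apply: cf; apply: lt_le_trans dx.
exists (Num.max (`|l| + 1) `|f c|) => x x0 xt; rewrite le_max.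
have [xd|dx] := ltP x d; first by rewrite near0.
by rewrite cM ?orbT// in_itv/= dx.
Qed.

(** Boundedness near 0 and on compact sets, together with decay as x^-2, give a
    bound by a multiple of 1 / (1 + x^2). *)
Lemma integral_lty (f : R -> R) (l t C : R) :
  (forall x : R, 0 <= f x) ->
  (forall x : R, 0 < x -> {for x, continuous f}) -> f x @[x --> 0^'+] --> l ->
  (forall x : R, t <= x -> f x <= C * x ^- 2) ->
  (\int[mu]_(x in Rpos) (f x)%:E < +oo)%E.
Proof.
move=> f0 cf fl fC.
(* beyond s the decay applies and 1 + x^2 <= 2 x^2 *)
pose s := Num.max t 1; have [M MP] := bounded_near0 s cf fl.
have s1 : 1 <= s by rewrite le_max lexx orbT.
have : mu.-integrable Rpos (EFin \o f).
  apply: (@integrable_pos _ _ (`|M| * (1 + s ^+ 2) + 2 * `|C|)) => // x x0.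
  have x20 : 0 < 1 + x ^+ 2 by rewrite ltr_wpDr ?sqr_ge0.
  rewrite ler_pdivlMr//; have [xs|sx] := leP x s.
    apply: (@le_trans _ _ (`|M| * (1 + s ^+ 2))); last by rewrite lerDl mulr_ge0.
    apply: ler_pM => //; first exact: ltW.
      by apply: le_trans (MP _ x0 xs) _; exact: ler_norm.
    by rewrite lerD2l ler_pXn2r ?nnegrE ?(ltW x0) ?(le_trans ler01 s1).
  apply: (@le_trans _ _ (2 * `|C|)); last first.
    by rewrite lerDr mulr_ge0// addr_ge0// sqr_ge0.
  rewrite ger0_norm//; apply: (@le_trans _ _ (`|C| * x ^- 2 * (2 * x ^+ 2))).
    apply: ler_pM => //; first exact: ltW.
      apply: le_trans (fC _ _) _; first by rewrite (le_trans _ (ltW sx))// le_max lexx.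
      by rewrite ler_pM2r ?invr_gt0 ?exprn_gt0// ler_norm.
    have x1 : 1 <= x by rewrite (le_trans s1)// ltW.
    have : 1 <= x ^+ 2 by rewrite exprn_ege1.
    by lra.
  rewrite le_eqVlt; apply/orP; left; apply/eqP; field.
  by rewrite gt_eqF.
move=> /integrableP[_]; under eq_integral => x _.
  rewrite /= ger0_norm//; over.
by [].
Qed.

End HalfLineBounds.

(** * The reference prior at finite and small scales *)

Section ReferencePrior.
Context {R : realType} (n r m : nat) (X : 'M[R]_(n, r)) (W : 'M[R]_(n, m)).
Notation mu := (@lebesgue_measure R).
Notation Rpos := (`]0%R, +oo[%classic : set R).
Hypothesis injX : injective (fun i : 'I_n => row i X).
Hypothesis WW : W^T *m W = 1%:M.

Lemma Sigma_mix_mx (th : R) : 0 < th -> Sigma 1 X th = th ^- 2 *: mix_mx X 2 (th ^- 2).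
Proof.
by move=> th0; apply/matrixP => i j; rewrite !mxE matern1_mix// sqrtr_ge0.
Qed.

Lemma Sigma_diag (th : R) i : Sigma 1 X th i i = 1.
Proof.
rewrite mxE subrr /enorm big1; last by move=> k _; rewrite mxE expr0n.
by rewrite sqrtr0 mul0r /matern eqxx.
Qed.

Lemma contrast_inj (v : 'cV[R]_m) : W *m v = 0 -> v = 0.
Proof. by move=> Wv; rewrite -[v]mul1mx -WW -mulmxA Wv mulmx0. Qed.

Lemma Sigma_posdef (th : R) : 0 < th -> posdef (Sigma 1 X th).
Proof.
move=> th0; have e0 : 0 < th ^- 2 by rewrite invr_gt0 exprn_gt0.
rewrite Sigma_mix_mx//; have [sM pM] := mix_mx_posdef 0 injX e0; split.
  by rewrite linearZ/= sM.
by move=> v /pM h; rewrite /qform -scalemxAr -scalemxAl mxE; exact: mulr_gt0.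
Qed.

(** The matrix F(e) for k = 2, and - F'(e) for k = 3. *)
Definition contrast_mx k (e : R) : 'M[R]_m := W^T *m mix_mx X k e *m W.

Lemma contrast_mxE k e p q :
  contrast_mx k e p q = \sum_i \sum_j (W i p * W j q) * mix k (sqdist X i j) e.
Proof.
rewrite /contrast_mx mxE exchange_big; apply: eq_bigr => j _ /=.
rewrite mxE mulr_suml; apply: eq_bigr => i _; rewrite !mxE; ring.
Qed.

Lemma contrast_mx_posdef (e : R) : 0 < e -> posdef (contrast_mx 2 e).
Proof. by move=> e0; apply: posdef_congr; [exact: contrast_inj|exact: mix_mx_posdef]. Qed.

Lemma SigmaW_contrast_mx (th : R) : 0 < th ->
  SigmaW 1 X W th = th ^- 2 *: contrast_mx 2 (th ^- 2).
Proof.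
by move=> th0; rewrite /SigmaW Sigma_mix_mx// -scalemxAr -scalemxAl.
Qed.

(** Derivative of e * mix_mx 2 e at e = th^-2 with respect to th. *)
Definition dSigma (th : R) : 'M[R]_n :=
  (- 2 * th ^- 3) *: (mix_mx X 2 (th ^- 2) - th ^- 2 *: mix_mx X 3 (th ^- 2)).

Lemma is_derive_invX2 (th : R) : 0 < th ->
  is_derive th 1 (fun t : R => t ^- 2) (- 2 * th ^- 3).
Proof.
move=> th0; have t1 : th ^+ 2 != 0 by rewrite expf_neq0// gt_eqF.
have d2 : is_derive th 1 (fun t : R => t ^+ 2) (2 * th).
  by apply: is_derive_eq; rewrite /GRing.scale/=; ring.
apply: (is_derive_eq (is_deriveV (f := fun t : R => t ^+ 2) t1 d2)).
by rewrite /GRing.scale/=; field; rewrite gt_eqF.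
Qed.

Lemma is_derive_mix_inv k (th : R) i j : 0 < th ->
  is_derive th 1 (fun t : R => mix k.+2 (sqdist X i j) (t ^- 2))
    (2 * th ^- 3 * mix k.+3 (sqdist X i j) (th ^- 2)).
Proof.
move=> th0; have e0 : 0 < th ^- 2 by rewrite invr_gt0 exprn_gt0.
have := @is_derive1_comp _ (mix k.+2 (sqdist X i j)) (fun t : R => t ^- 2) th _ _
  (is_derive_mix k (sqdist_ge0 X i j) e0) (is_derive_invX2 th0).
by move=> d; apply: (is_derive_eq d); ring.
Qed.

Lemma is_derive_Sigma (th : R) i j : 0 < th ->
  is_derive th 1 (fun t => Sigma 1 X t i j) (dSigma th i j).
Proof.
move=> th0.
have d := is_deriveM (is_derive_invX2 th0) (is_derive_mix_inv 0 i j th0).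
have {}d : is_derive th 1 (fun t : R => t ^- 2 * mix 2 (sqdist X i j) (t ^- 2)) (dSigma th i j).
  apply: (is_derive_eq d); rewrite /GRing.scale/= /dSigma !mxE; ring.
apply: near_eq_is_derive d; near=> t.
have t0 : 0 < t by near: t; exact: lt_nbhsr.
by rewrite Sigma_mix_mx// !mxE.
Unshelve. all: by end_near. Qed.

Lemma derive_SigmaW (th : R) : 0 < th ->
  (SigmaW 1 X W)^`()%classic th = W^T *m dSigma th *m W.
Proof.
move=> th0; apply: derive1_mx => p q.
have -> : (fun t => SigmaW 1 X W t p q) =
    \sum_(j < n) \sum_(i < n) (fun t => W i p * W j q * Sigma 1 X t i j).
  apply/funext => t; rewrite /SigmaW mxE fct_sumE; apply: eq_bigr => j _ /=.
  rewrite mxE mulr_suml fct_sumE; apply: eq_bigr => i _; rewrite [W^T _ _]mxE; ring.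
have -> : (W^T *m dSigma th *m W) p q =
    \sum_(j < n) \sum_(i < n) W i p * W j q * dSigma th i j.
  rewrite mxE; apply: eq_bigr => j _ /=.
  rewrite mxE mulr_suml; apply: eq_bigr => i _; rewrite [W^T _ _]mxE; ring.
apply: is_derive_sum => j; apply: is_derive_sum => i.
by apply: is_deriveZ; exact: is_derive_Sigma.
Qed.

Lemma refpriorE (th : R) : 0 < th ->
  refprior 1 X W th =
  Num.sqrt (dispersion (W^T *m dSigma th *m W *m invmx (SigmaW 1 X W th))).
Proof. by move=> th0; rewrite /refprior derive_SigmaW. Qed.

Lemma refprior_ge0 (th : R) : 0 <= refprior 1 X W th.
Proof. exact: sqrtr_ge0. Qed.

Lemma SigmaW_posdef (th : R) : 0 < th -> posdef (SigmaW 1 X W th).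
Proof. by move=> th0; apply: posdef_congr; [exact: contrast_inj|exact: Sigma_posdef]. Qed.

(** Used with th tending to a positive number, for continuity, and to 0. *)
Lemma cvg_refprior (F : set_system R) {FF : Filter F} (S0 D0 : 'M[R]_n) :
  (\forall th \near F, 0 < th) -> (W^T *m S0 *m W) \in unitmx ->
  mxcvg F (Sigma 1 X) S0 -> mxcvg F dSigma D0 ->
  refprior 1 X W th @[th --> F] -->
    Num.sqrt (dispersion (W^T *m D0 *m W *m invmx (W^T *m S0 *m W))).
Proof.
move=> F0 uS cS cD.
have : Num.sqrt (dispersion (W^T *m dSigma th *m W *m invmx (SigmaW 1 X W th)))
    @[th --> F] --> Num.sqrt (dispersion (W^T *m D0 *m W *m invmx (W^T *m S0 *m W))).
  apply: (cvg_comp _ Num.sqrt); last exact: sqrt_continuous.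
  have cW (A : R -> 'M[R]_n) A0 : mxcvg F A A0 ->
      mxcvg F (fun t => W^T *m A t *m W) (W^T *m A0 *m W).
    move=> cA; apply: mxcvg_mul; last exact: mxcvg_cst.
    by apply: mxcvg_mul => //; exact: mxcvg_cst.
  apply: cvg_dispersion; apply: mxcvg_mul; first exact: cW.
  by apply: mxcvg_inv => //; exact: cW.
apply: cvg_trans; apply: near_eq_cvg; near=> th.
by rewrite refpriorE//; near: th.
Unshelve. all: by end_near. Qed.

Lemma continuous_refprior (th : R) : 0 < th -> {for th, continuous (refprior 1 X W)}.
Proof.
move=> th0; suff : refprior 1 X W t @[t --> th] --> refprior 1 X W th by [].
rewrite [X in _ --> X]refpriorE//.
have der_cont (f : R -> R) d : is_derive th 1 f d -> {for th, continuous f}.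
  by case=> /derivable1_diffP/differentiable_continuous.
apply: cvg_refprior.
- exact: lt_nbhsr.
- exact/posdef_unit/SigmaW_posdef.
- by move=> i j; apply: der_cont (is_derive_Sigma i j th0).
- move=> i j; have c2 k := der_cont _ _ (is_derive_mix_inv k i j th0).
  have c1 := der_cont _ _ (is_derive_invX2 th0).
  under eq_fun do rewrite !mxE; rewrite !mxE; apply: cvgM.
    apply: cvgM; first exact: cvg_cst.
    apply: (@continuous_comp _ _ _ (fun a : R => a ^+ 3) GRing.inv).
      exact: exprn_continuous.
    by apply: inv_continuous; rewrite expf_neq0// gt_eqF.
  by apply: cvgB; [exact: (c2 0)|apply: cvgM; [exact: c1|exact: (c2 1)]].
Qed.

Lemma cvg0_small (f : R -> R) (C : R) (k : nat) :
  (forall x : R, 0 < x -> `|f x| <= C * x ^+ k.+1) -> f x @[x --> 0^'+] --> 0.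
Proof.
move=> fC.
have c0 : C * x ^+ k.+1 @[x --> (0:R)^'+] --> 0.
  apply: cvg_at_right_filter; rewrite -[X in _ --> X](mulr0 C); apply: cvgM; first exact: cvg_cst.
  by have := @exprn_continuous R k.+1 0; rewrite /continuous_at expr0n.
apply: norm_cvg0; apply: (@squeeze_cvgr _ _ _ _ (cst 0) (fun x => C * x ^+ k.+1)) => //;
  last exact: cvg_cst.
by near=> x; rewrite normr_ge0/= fC.
Unshelve. all: by end_near. Qed.

(** Off the diagonal, e * mix 2 c e = O(e^-1) = O(th^2). *)
Lemma cvg0_Sigma : mxcvg (0:R)^'+ (Sigma 1 X) 1%:M.
Proof.
move=> i j; rewrite mxE; have [<-|ij] := eqVneq i j.
  under eq_fun do rewrite Sigma_diag; exact: cvg_cst.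
have c0 := sqdist_gt0 injX ij.
apply: (@cvg0_small _ (2 * ((1 + (2 / sqdist X i j ^+ 2)) * (pi / 2))) 1) => x x0.
have e0 : 0 < x ^- 2 by rewrite invr_gt0 exprn_gt0.
rewrite Sigma_mix_mx// !mxE ger0_norm; last by rewrite mulr_ge0 ?mix_ge0// ltW.
apply: (le_trans (ler_wpM2l (ltW e0) (mix_le 2 c0 e0))).
rewrite le_eqVlt; apply/orP; left; apply/eqP.
have -> : 2`!%:R = 2 :> R by [].
by field; rewrite !gt_eqF.
Qed.

(** The diagonal of Sigma is constant. Off the diagonal the derivative is
    th^-3 * O(e^-2) = O(th). *)
Lemma cvg0_dSigma : mxcvg (0:R)^'+ dSigma 0.
Proof.
move=> i j; rewrite [X in _ --> X]mxE.
have [<-|ij] := eqVneq i j.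
  have : cst 0 x @[x --> (0:R)^'+] --> (0:R) by exact: cvg_cst.
  apply: cvg_trans; apply: near_eq_cvg; near=> x.
  have x0 : 0 < x by near: x; exact: nbhs_right_gt.
  have [_ <-] := is_derive_Sigma i i x0.
  rewrite (_ : (fun t => Sigma 1 X t i i) = cst 1) ?derive_cst//.
  by apply/funext => t; exact: Sigma_diag.
have c0 := sqdist_gt0 injX ij.
apply: (@cvg0_small _ (16 * ((1 + (2 / sqdist X i j ^+ 2)) * (pi / 2))) 0) => x x0.
have e0 : 0 < x ^- 2 by rewrite invr_gt0 exprn_gt0.
have x3 : 0 < 2 * x ^- 3 by rewrite mulr_gt0// invr_gt0 exprn_gt0.
rewrite !mxE mulNr mulNr normrN normrM (gtr0_norm x3).
apply: (@le_trans _ _ (2 * x ^- 3 *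
  (mix 2 (sqdist X i j) (x ^- 2) + x ^- 2 * mix 3 (sqdist X i j) (x ^- 2)))).
  rewrite ler_pM2l//; apply: le_trans (ler_normB _ _) _.
  by rewrite !ger0_norm// ?mulr_ge0 ?mix_ge0// ltW.
apply: (@le_trans _ _ (2 * x ^- 3 *
   (2`!%:R * (x ^- 2) ^- 2 * ((1 + (2 / sqdist X i j ^+ 2)) * (pi / 2)) +
    x ^- 2 * (3`!%:R * (x ^- 2) ^- 3 * ((1 + (2 / sqdist X i j ^+ 2)) * (pi / 2)))))).
  by rewrite ler_pM2l// lerD ?mix_le// ler_pM2l// mix_le.
rewrite le_eqVlt; apply/orP; left; apply/eqP.
have -> : 2`!%:R = 2 :> R by [].
have -> : 3`!%:R = 6 :> R by [].
by field; rewrite !gt_eqF.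
Unshelve. all: by end_near. Qed.

Lemma cvg0_refprior : exists l : R, refprior 1 X W th @[th --> 0^'+] --> l.
Proof.
eexists; apply: (cvg_refprior _ _ cvg0_Sigma cvg0_dSigma).
  exact: nbhs_right_gt.
by rewrite mulmx1 WW unitmx1.
Qed.

Lemma measurable_refprior : measurable_fun Rpos (refprior 1 X W).
Proof. by apply: measurable_pos; exact: continuous_refprior. Qed.

End ReferencePrior.

(** * The reference prior at large scales *)

Section AffineKriging.
Context {R : realType} (n r m : nat) (X : 'M[R]_(n, r)) (W : 'M[R]_(n, m)).
Notation mu := (@lebesgue_measure R).
Notation Rpos := (`]0%R, +oo[%classic : set R).
Hypothesis injX : injective (fun i : 'I_n => row i X).
Hypothesis WW : W^T *m W = 1%:M.
Hypothesis HW : (affineH X)^T *m W = 0.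

Lemma sum_W q : \sum_i W i q = 0.
Proof.
have : (row_mx (const_mx 1 : 'M[R]_(n, 1)) X)^T *m W = 0 := HW.
rewrite tr_row_mx mul_col_mx -col_mx0 => /eq_col_mx[h _].
transitivity (((const_mx 1 : 'M[R]_(n, 1))^T *m W) 0 q); last by rewrite h mxE.
by rewrite mxE; apply: eq_bigr => i _; rewrite !mxE mul1r.
Qed.

Lemma sum_XW l q : \sum_i X i l * W i q = 0.
Proof.
have : (row_mx (const_mx 1 : 'M[R]_(n, 1)) X)^T *m W = 0 := HW.
rewrite tr_row_mx mul_col_mx -col_mx0 => /eq_col_mx[_ h].
transitivity ((X^T *m W) l q); last by rewrite h mxE.
by rewrite mxE; apply: eq_bigr => i _; rewrite mxE.
Qed.

Definition contrast_prod p q : 'M[R]_n := \matrix_(i, j) (W i p * W j q).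

Lemma sum_contrast_prod p q : \sum_i \sum_j contrast_prod p q i j = 0.
Proof.
transitivity ((\sum_i W i p) * \sum_j W j q); last by rewrite sum_W mul0r.
rewrite mulr_suml; apply: eq_bigr => i _.
by rewrite mulr_sumr; apply: eq_bigr => j _; exact: mxE.
Qed.

(** In |x_i - x_j|^2 = |x_i|^2 + |x_j|^2 - 2 x_i.x_j every term is affine in x_i or in
    x_j, so W kills it from one side. This is where the affine trend matters. *)
Lemma sum_contrast_prod_sqdist p q : \sum_i \sum_j contrast_prod p q i j * sqdist X i j = 0.
Proof.
(* an abstract N keeps mulr_sumr from opening the squared norms *)
have [N NE] : exists N : 'I_n -> R, forall i, \sum_l X i l ^+ 2 = N i by eexists.
have -> : \sum_i \sum_j contrast_prod p q i j * sqdist X i j =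
   (\sum_i W i p * N i) * (\sum_j W j q) + (\sum_i W i p) * (\sum_j W j q * N j)
   - 2 * \sum_l (\sum_i X i l * W i p) * (\sum_j X j l * W j q).
  rewrite [X in _ = _ - 2 * X](_ : _ =
      \sum_i \sum_j \sum_l (X i l * W i p) * (X j l * W j q)); last first.
    rewrite [RHS](eq_bigr (fun i => \sum_l \sum_j (X i l * W i p) * (X j l * W j q))); last first.
      by move=> i _; rewrite exchange_big.
    rewrite [RHS]exchange_big/=; apply: eq_bigr => l _; rewrite mulr_suml.
    by apply: eq_bigr => i _; rewrite mulr_sumr.
  rewrite !mulr_suml mulr_sumr -sumrN -!big_split/=; apply: eq_bigr => i _.
  rewrite !mulr_sumr -sumrN -!big_split/=; apply: eq_bigr => j _.
  rewrite mxE sqdistE.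
  have -> : \sum_k (X i k - X j k) ^+ 2 =
     N i + N j - 2 * \sum_l X i l * X j l.
    rewrite -!NE mulr_sumr -sumrN -!big_split/=; apply: eq_bigr => k _; ring.
  have -> : \sum_l X i l * W i p * (X j l * W j q) = W i p * W j q * \sum_l X i l * X j l.
    by rewrite mulr_sumr; apply: eq_bigr => l _; ring.
  ring.
rewrite !sum_W mulr0 mul0r addr0 big1 ?mulr0 ?subr0// => l _.
by rewrite !sum_XW mul0r.
Qed.

Lemma contrast_mx_sum k e p q :
  contrast_mx X W k e p q = \sum_i \sum_j contrast_prod p q i j * mix k (sqdist X i j) e.
Proof. by rewrite contrast_mxE; apply: eq_bigr => i _; apply: eq_bigr => j _; rewrite mxE. Qed.

Definition contrast_mx0 : 'M[R]_m := \matrix_(p, q) gauss_form_limit X (contrast_prod p q).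

Lemma cvg_contrast_mx2 : mxcvg (0 : R)^'+ (contrast_mx X W 2) contrast_mx0.
Proof.
move=> p q; rewrite mxE; under eq_fun do rewrite contrast_mx_sum.
by apply: cvg_sum_mix2; [exact: sum_contrast_prod|exact: sum_contrast_prod_sqdist].
Qed.

(** The weight exp(- e / a) decreases in e and multiplies a nonnegative form. *)
Lemma qform_contrast_mx2_anti (e1 e2 : R) (v : 'cV[R]_m) : 0 < e1 -> e1 <= e2 ->
  qform (contrast_mx X W 2 e2) v <= qform (contrast_mx X W 2 e1) v.
Proof.
move=> e10 e12; have e20 := lt_le_trans e10 e12.
have E e : 0 < e -> qform (contrast_mx X W 2 e) v =
    \int[mu]_(a in Rpos) (gauss_form X ((W *m v) *m (W *m v)^T) a * mix_density 2 0 e a).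
  move=> e0; rewrite -sum_mix//.
  have -> : qform (contrast_mx X W 2 e) v = qform (mix_mx X 2 e) (W *m v).
    by rewrite /qform /contrast_mx trmx_mul !mulmxA.
  rewrite qformE; apply: eq_bigr => i _; apply: eq_bigr => j _.
  by rewrite [in RHS]mxE big_ord1 [_^T _ _]mxE [mix_mx _ _ _ _ _]mxE.
rewrite !E//; apply: le_Rintegral => //; [exact: integrable_gauss_form_mix_density..|].
move=> a; rewrite RposE => a0; rewrite ler_wpM2l ?gauss_form_psd//; first exact: ltW.
rewrite /mix_density !mul0r oppr0 expR0 !mulr1 ler_pM2r ?invr_gt0 ?exprn_gt0//.
by rewrite ler_expR lerN2 ler_pM2r ?invr_gt0.
Qed.

(** By monotonicity the limit at 0 dominates the value at e = 1. *)
Lemma contrast_mx0_posdef : posdef contrast_mx0.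
Proof.
split.
  apply/matrixP => p q; rewrite [LHS]mxE.
  have h : contrast_mx X W 2 e q p @[e --> (0:R)^'+] --> contrast_mx0 p q.
    have h0 : contrast_mx X W 2 e p q @[e --> (0:R)^'+] --> contrast_mx0 p q.
      exact: cvg_contrast_mx2.
    apply: cvg_trans h0; apply: near_eq_cvg; near=> e.
    have e0 : 0 < e by near: e; exact: nbhs_right_gt.
    by have [sM _] := contrast_mx_posdef injX WW e0; rewrite -[in LHS]sM mxE.
  have h1 : contrast_mx X W 2 e q p @[e --> (0:R)^'+] --> contrast_mx0 q p.
    exact: cvg_contrast_mx2.
  by have := cvg_unique _ h1 h; apply.
move=> v v0; apply: (lt_le_trans (y := qform (contrast_mx X W 2 1) v)).
  by have [_] := contrast_mx_posdef injX WW ltr01; apply.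
have cq : qform (contrast_mx X W 2 e) v @[e --> (0:R)^'+] --> qform contrast_mx0 v.
  apply: mxcvg_mul; last exact: mxcvg_cst.
  apply: mxcvg_mul; [exact: mxcvg_cst|exact: cvg_contrast_mx2].
rewrite -(cvg_lim _ cq)//; apply: limr_ge; first by apply/cvg_ex; eexists; exact: cq.
near=> e; apply: qform_contrast_mx2_anti; first by near: e; exact: nbhs_right_gt.
by near: e; exact: nbhs_right_le.
Unshelve. all: by end_near. Qed.

Lemma cvg_invX2 : (th : R) ^- 2 @[th --> +oo] --> 0^'+.
Proof.
move=> A [d /= d0 dA]; suff : \forall th \near +oo_R, A (th ^- 2) by [].
near=> th.
have th1 : 1 <= th by near: th; apply: nbhs_pinfty_ge; exact: num_real.
have th0 : 0 < th by exact: lt_le_trans th1.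
have thd : d^-1 < th by near: th; apply: nbhs_pinfty_gt; rewrite num_real.
apply: dA => /=; last by rewrite invr_gt0 exprn_gt0.
rewrite sub0r normrN gtr0_norm ?invr_gt0 ?exprn_gt0//.
rewrite -[d]invrK ltf_pV2 ?posrE ?invr_gt0 ?exprn_gt0//.
by apply: lt_le_trans thd _; rewrite expr2 ler_peMr// ltW.
Unshelve. all: by end_near. Qed.

(** The multiple of the identity in the logarithmic derivative, - (2 / th) I, drops
    out of the dispersion. *)
Lemma refprior_dispersion (th : R) : (0 < m)%N -> 0 < th ->
  refprior 1 X W th = 2 * th ^- 3 *
   Num.sqrt (dispersion (contrast_mx X W 3 (th ^- 2) *m invmx (contrast_mx X W 2 (th ^- 2)))).
Proof.
move=> m0 th0; have e0 : 0 < th ^- 2 by rewrite invr_gt0 exprn_gt0.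
have th1 : th != 0 by rewrite gt_eqF.
have uM := posdef_unit (contrast_mx_posdef injX WW e0).
have eD : W^T *m dSigma X th *m W =
    (- 2 * th ^- 3) *: (contrast_mx X W 2 (th ^- 2) - th ^- 2 *: contrast_mx X W 3 (th ^- 2)).
  rewrite /dSigma /contrast_mx -scalemxAr -scalemxAl; congr (_ *: _).
  by rewrite mulmxBr mulmxBl -scalemxAr -scalemxAl.
have eA : (- 2 * th ^- 3) *: (contrast_mx X W 2 (th ^- 2) - th ^- 2 *: contrast_mx X W 3 (th ^- 2))
    *m ((th ^- 2)^-1 *: invmx (contrast_mx X W 2 (th ^- 2))) =
    (- 2 / th)%:M + (2 * th ^- 3) *:
      (contrast_mx X W 3 (th ^- 2) *m invmx (contrast_mx X W 2 (th ^- 2))).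
  rewrite -scalemxAl -scalemxAr mulmxBl mulmxV// -scalemxAl scalerA scalerBr scalerA.
  by rewrite scalemx1 -scaleNr; congr (_%:M + _ *: _); field.
rewrite refpriorE// SigmaW_contrast_mx// invmxZ; last by rewrite unitmxZ ?unitfE ?gt_eqF.
rewrite eD eA dispersion_affine// sqrtrM ?sqr_ge0// sqrtr_sqr gtr0_norm//.
by rewrite mulr_gt0// invr_gt0 exprn_gt0.
Qed.

(** The entries of F'(e) are O(ln (1 / e)) and those of F(e)^-1 converge. *)
Lemma dispersion_bound : exists2 c : R, 0 <= c &
  \forall e \near (0 : R)^'+,
    Num.sqrt (dispersion (contrast_mx X W 3 e *m invmx (contrast_mx X W 2 e))) <= c * ln e^-1.
Proof.
pose C : R := \sum_p \sum_q gauss_form_bound X (contrast_prod p q).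
pose K (A : 'M[R]_m) : R := \sum_p \sum_q `|A p q|.
have C0 : 0 <= C by apply: sumr_ge0 => p _; apply: sumr_ge0 => q _; exact: gauss_form_bound_ge0.
have Cle p q : gauss_form_bound X (contrast_prod p q) <= C.
  rewrite /C (bigD1 p)//= (bigD1 q)//= -addrA lerDl addr_ge0//.
    by apply: sumr_ge0 => ? _; exact: gauss_form_bound_ge0.
  by apply: sumr_ge0 => ? _; apply: sumr_ge0 => ? _; exact: gauss_form_bound_ge0.
have Kle (A : 'M[R]_m) q : \sum_p `|A p q| <= K A.
  by apply: ler_sum => p _; rewrite (bigD1 q)//= lerDl sumr_ge0.
have cK : K (invmx (contrast_mx X W 2 e)) @[e --> (0:R)^'+] --> K (invmx contrast_mx0).
  apply: cvg_sumR => p _; apply: cvg_sumR => q _; apply: cvg_norm.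
  by apply: mxcvg_inv; [exact/posdef_unit/contrast_mx0_posdef|exact: cvg_contrast_mx2].
exists (m%:R * (4 * C * (K (invmx contrast_mx0) + 1))).
  by rewrite !mulr_ge0// addr_ge0// sumr_ge0// => p _; exact: sumr_ge0.
near=> e.
have e0 : 0 < e by near: e; exact: nbhs_right_gt.
have e2 : e <= 2^-1 by near: e; apply: nbhs_right_le; rewrite invr_gt0.
have ln0 : 0 <= ln e^-1.
  by rewrite ln_ge0// invf_ge1// (le_trans e2)// invf_le1// ler1n.
have Ke : K (invmx (contrast_mx X W 2 e)) <= K (invmx contrast_mx0) + 1.
  by apply/ltW; near: e; apply: (cvgr_lt _ cK); rewrite ltrDl.
have ent p q : `|(contrast_mx X W 3 e *m invmx (contrast_mx X W 2 e)) p q| <=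
    4 * C * (K (invmx contrast_mx0) + 1) * ln e^-1.
  rewrite mxE; apply: le_trans (ler_norm_sum _ _ _) _.
  apply: (@le_trans _ _ (\sum_k (4 * C * ln e^-1) * `|invmx (contrast_mx X W 2 e) k q|)).
    apply: ler_sum => k _; rewrite normrM ler_wpM2r// contrast_mx_sum.
    apply: le_trans (sum_mix3_le (sum_contrast_prod p k) (sum_contrast_prod_sqdist p k) e0 e2) _.
    by rewrite ler_wpM2r// ler_pM2l.
  rewrite -mulr_sumr [leRHS]mulrAC ler_wpM2l ?mulr_ge0//.
  by apply: le_trans Ke.
apply: (@le_trans _ _ (Num.sqrt ((m%:R * (4 * C * (K (invmx contrast_mx0) + 1) * ln e^-1)) ^+ 2))).
  by rewrite ler_wsqrtr// dispersion_le.
rewrite sqrtr_sqr ger0_norm ?mulrA//.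
by rewrite !mulr_ge0// addr_ge0// sumr_ge0// => p _; exact: sumr_ge0.
Unshelve. all: by end_near. Qed.

Lemma refprior_bound : (0 < m)%N -> exists2 c : R, 0 <= c &
  \forall th \near +oo_R, refprior 1 X W th <= c * (th ^- 3 * ln th).
Proof.
move=> m0; have [c c0 cP] := dispersion_bound.
exists (4 * c); first by rewrite mulr_ge0.
have := cvg_invX2 cP; rewrite /= => h.
near=> th.
have th0 : 0 < th by near: th; exact: nbhs_pinfty_gt.
have th3 : 0 < 2 * th ^- 3 by rewrite mulr_gt0// invr_gt0 exprn_gt0.
rewrite refprior_dispersion//.
apply: (@le_trans _ _ (2 * th ^- 3 * (c * ln (th ^- 2)^-1))).
  by rewrite ler_pM2l//; near: th; exact: h.
by rewrite invrK lnXn// -[ln th *+ 2]mulr_natr le_eqVlt; apply/orP; left; apply/eqP; ring.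
Unshelve. all: by end_near. Qed.

Lemma refprior_bigO : (0 < m)%N ->
  refprior 1 X W =O_ (pinfty_nbhs R) (fun theta : R => theta ^- 3 * ln theta).
Proof.
move=> m0; have [c c0 cP] := refprior_bound m0.
apply/eqO_exP; exists (c + 1); first by rewrite ltr_wpDl.
near=> th.
have th1 : 1 <= th by near: th; apply: nbhs_pinfty_ge; exact: num_real.
rewrite ger0_norm ?refprior_ge0//.
have g0 : 0 <= th ^- 3 * ln th.
  by rewrite mulr_ge0 ?ln_ge0// invr_ge0 exprn_ge0// (le_trans ler01).
rewrite ger0_norm//; apply: (@le_trans _ _ (c * (th ^- 3 * ln th))).
  by near: th.
by rewrite ler_wpM2r// lerDl.
Unshelve. all: by end_near. Qed.

Lemma refprior_integral : (0 < m)%N ->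
  (\int[mu]_(th in Rpos) (refprior 1 X W th)%:E < +oo)%E.
Proof.
move=> m0; have [c c0 [t [_ tP]]] := refprior_bound m0.
have [l cl] := cvg0_refprior injX WW.
apply: (@integral_lty _ _ l (Num.max (t + 1) 1) c _ _ cl).
- exact: refprior_ge0.
- by move=> x; exact: continuous_refprior.
move=> x; rewrite ge_max => /andP[tx x1].
have x0 : 0 < x by exact: lt_le_trans x1.
apply: le_trans (tP _ _) _; first by rewrite (lt_le_trans _ tx)// ltrDl.
rewrite ler_wpM2l//.
apply: (@le_trans _ _ (x ^- 3 * x)).
  by rewrite ler_pM2l ?invr_gt0 ?exprn_gt0// ltW// ln_sublinear.
by rewrite le_eqVlt; apply/orP; left; apply/eqP; field; rewrite gt_eqF.
Qed.

End AffineKriging.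

(** * The integrated likelihood *)

Section IntegratedLikelihood.
Context {R : realType}.
Notation mu := (@lebesgue_measure R).
Notation Rpos := (`]0%R, +oo[%classic : set R).

(** The exponent is expanded in powers of be, as in [integral_Rn_gauss]. *)
Lemma gauss_densityE n p (S : 'M[R]_n) (H : 'M[R]_(n, p)) y (s : R) be :
  posdef S -> gauss_density S H y s be =
  (2 * pi * s) `^ (- (n%:R / 2)) * (\det S) `^ (- 2^-1) *
  expR (- (2 * s)^-1 * (qform (H^T *m invmx S *m H) be -
     2 * ((H^T *m invmx S *m y)^T *m be) 0 0 + qform (invmx S) y)).
Proof.
move=> /posdef_invmx[sS _]; rewrite /gauss_density; congr (_ * expR (_ * _)).
have -> : (y - H *m be)^T = y^T - be^T *m H^T.
  by rewrite linearB/= trmx_mul.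
rewrite !(mulmxBl, mulmxBr) /qform !trmx_mul trmxK sS !mulmxA.
have -> : be^T *m H^T *m invmx S *m y = y^T *m invmx S *m H *m be.
  have tr1 (A : 'M[R]_1) : A^T = A by apply/matrixP => i j; rewrite mxE !ord1.
  by rewrite -[LHS]tr1 !trmx_mul !trmxK sS !mulmxA.
have entB (A B : 'M[R]_1) : (A - B) 0 0 = A 0 0 - B 0 0 by rewrite !mxE.
rewrite !entB; ring.
Qed.

Lemma gauss_moment (k : nat) : exists2 M : R, 0 < M &
  (\int[mu]_(t in Rpos) (2 * t ^+ k * expR (- (t ^+ 2 / 2)))%:E = M%:E)%E.
Proof.
pose f (t : R) := 2 * t ^+ k * expR (- (t ^+ 2 / 2)).
have cf (t : R) : 0 < t -> {for t, continuous f}.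
  move=> _; apply: cvgM.
    by apply: cvgM; [exact: cvg_cst|exact: exprn_continuous].
  apply: (cvg_comp _ expR); last exact: continuous_expR.
  by apply: cvgN; apply: cvgM; [exact: exprn_continuous|exact: cvg_cst].
have f0 (t : R) : 0 < t -> 0 <= f t.
  by move=> t0; rewrite !mulr_ge0 ?expR_ge0// exprn_ge0// ltW.
have pw j (t : R) : 0 < t -> t ^+ j * expR (- (t ^+ 2 / 2)) <= 1 + 2 ^+ j * j`!%:R.
  move=> t0; have e0 := expR_gt0 (t ^+ 2 / 2).
  (* u <= 1 + u^2 for u = t^j; then t^(2j) = 2^j (t^2 / 2)^j <= 2^j j! exp(t^2 / 2) *)
  have h : t ^+ j <= 1 + t ^+ 2 ^+ j.
    rewrite exprAC; have [t1|t1] := leP (t ^+ j) 1.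
      by rewrite (le_trans t1)// lerDl sqr_ge0.
    rewrite (@le_trans _ _ (t ^+ j ^+ 2))//; last by rewrite lerDr.
    by rewrite expr2 ler_peMr// ltW// (lt_trans ltr01).
  rewrite expRN ler_pdivrMr// mulrDl mul1r (le_trans h)// lerD//.
    by rewrite -expR0 ler_expR divr_ge0// sqr_ge0.
  rewrite -mulrA -[X in X ^+ j](@divfK _ 2)// exprMn mulrC ler_pM2l ?exprn_gt0//.
  by apply: exprn_le_expR; rewrite divr_ge0 ?sqr_ge0.
pose C := 2 * ((1 + 2 ^+ k * k`!%:R) + (1 + 2 ^+ k.+2 * k.+2`!%:R)) : R.
have intf : mu.-integrable Rpos (EFin \o f).
  apply: (@integrable_pos _ _ C) => // t t0.
  have t20 : 0 < 1 + t ^+ 2 by rewrite ltr_wpDr ?sqr_ge0.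
  rewrite ger0_norm ?f0// ler_pdivlMr// /f /C.
  have h1 := pw k t t0; have h2 := pw k.+2 t t0.
  move: h1 h2; set E := expR _; rewrite [t ^+ k.+2]exprS [t ^+ k.+1]exprS => h1 h2.
  have -> : 2 * t ^+ k * E * (1 + t ^+ 2) = 2 * (t ^+ k * E + t * (t * t ^+ k) * E) by ring.
  by rewrite ler_pM2l// lerD.
exists (\int[mu]_(t in Rpos) f t).
  apply: (@Rintegral_pos_gt0 _ _ 1) => //.
  by rewrite /f expr1n mulr1 mulr_gt0 ?expR_gt0.
by rewrite /Rintegral fineK// integrable_fin_num.
Qed.

Lemma continuous_scale (a q s : R) : 0 < s -> {for s, continuous
  (fun s => (2 * pi * s) `^ a * expR (- (2 * s)^-1 * q) * s^-1)}.
Proof.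
have pi20 : 0 < 2 * pi :> R by rewrite mulr_gt0 ?pi_gt0.
move=> y0; apply: cvgM; last by apply: inv_continuous; rewrite gt_eqF.
  apply: cvgM.
    apply: (@continuous_comp _ _ _ (fun s : R => 2 * pi * s) (fun x => x `^ a)).
      by apply: cvgM; [exact: cvg_cst|exact: cvg_id].
    apply/differentiable_continuous/derivable1_diffP/derivable_powR.
    by rewrite in_itv/= andbT mulr_gt0.
  apply: (cvg_comp _ expR); last exact: continuous_expR.
  apply: cvgM; last exact: cvg_cst.
  apply: cvgN; apply: (@continuous_comp _ _ _ (fun s : R => 2 * s) GRing.inv).
    by apply: cvgM; [exact: cvg_cst|exact: cvg_id].
  by apply: inv_continuous; rewrite gt_eqF// mulr_gt0.
Qed.

(** Substitute s = q / t^2: the power of q comes out, and Gaussian moments with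
    natural exponents remain. *)
Lemma scale_mixture (m : nat) (q : R) : 0 < q ->
  (\int[mu]_(s in Rpos) ((2 * pi * s) `^ (- (m.+1%:R / 2)) * expR (- (2 * s)^-1 * q) * s^-1)%:E
  = ((2 * pi) `^ (- (m.+1%:R / 2)) * q `^ (- (m.+1%:R / 2)))%:E *
   \int[mu]_(t in Rpos) (2 * t ^+ m * expR (- (t ^+ 2 / 2)))%:E)%E.
Proof.
move=> q0; have pi20 : 0 < 2 * pi :> R by rewrite mulr_gt0 ?pi_gt0.
pose a : R := - (m.+1%:R / 2).
have dF (t : R) : 0 < t -> is_derive t 1 (fun t => q * t ^- 2) (- (2 * q * t ^- 3)).
  move=> t0; have d := is_deriveZ q (is_derive_invX2 t0).
  by apply: (is_derive_eq d); rewrite /GRing.scale/=; ring.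
have cpow k (t : R) : 0 < t -> {for t, continuous (fun t : R => t ^- k)}.
  move=> t0; apply: (@continuous_comp _ _ _ (fun a : R => a ^+ k) GRing.inv).
    exact: exprn_continuous.
  by apply: inv_continuous; rewrite expf_neq0// gt_eqF.
rewrite (ge0_substitution_decreasing (E := Rpos)
  (G := fun s => (2 * pi * s) `^ a * expR (- (2 * s)^-1 * q) * s^-1) dF).
- rewrite -ge0_integralZl_EFin//.
  + apply: eq_integral => t; rewrite inE RposE => t0; rewrite -EFinM; congr (_%:E).
    have t1 : t != 0 by rewrite gt_eqF.
    have q1 : q != 0 by rewrite gt_eqF.
    have qt0 : 0 <= q * t ^- 2 by rewrite mulr_ge0 ?invr_ge0 ?exprn_ge0 ?ltW.
    have ta : (t ^- 2) `^ a = t ^+ m.+1.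
      rewrite -(powR_invn 2 (ltW t0)) -powRrM -(powR_mulrn m.+1 (ltW t0)) /a.
      by congr (_ `^ _); field.
    rewrite opprK -/a [(2 * pi * (q * t ^- 2)) `^ a](powRM a (ltW pi20) qt0).
    rewrite [(q * t ^- 2) `^ a]powRM ?invr_ge0 ?exprn_ge0 ?(ltW t0) ?(ltW q0)// ta.
    have -> : - (2 * (q * t ^- 2))^-1 * q = - (t ^+ 2 / 2) by field; rewrite t1 q1.
    rewrite exprS; field; exact/andP.
  + move=> t; rewrite RposE => t0.
    by rewrite lee_fin !mulr_ge0 ?expR_ge0 ?exprn_ge0 ?(ltW t0).
  + apply/measurable_EFinP; apply: measurable_pos => t _; apply: cvgM.
      by apply: cvgM; [exact: cvg_cst|exact: exprn_continuous].
    apply: (cvg_comp _ expR); last exact: continuous_expR.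
    by apply: cvgN; apply: cvgM; [exact: exprn_continuous|exact: cvg_cst].
  + by rewrite mulr_ge0 ?powR_ge0.
- by move=> t t0; rewrite oppr_lt0 !mulr_gt0// invr_gt0 exprn_gt0.
- by move=> t t0; apply: cvgN; apply: cvgM; [exact: cvg_cst|exact: cpow].
- by move=> t t0; rewrite RposE mulr_gt0// invr_gt0 exprn_gt0.
- move=> y; rewrite RposE => y0; exists (Num.sqrt (q / y)).
    by rewrite sqrtr_gt0 divr_gt0.
  by rewrite sqr_sqrtr ?divr_ge0 ?ltW//; field; rewrite !gt_eqF.
- by move=> y; rewrite RposE; exact: continuous_scale.
- by move=> y; rewrite RposE => y0; rewrite !mulr_ge0 ?powR_ge0 ?expR_ge0// invr_ge0 ltW.
Qed.

(** The integrated likelihood up to a constant, A being the covariance of the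
    contrasts w = W^T y. *)
Definition profile m (A : 'M[R]_m) (w : 'cV[R]_m) : R :=
  (\det A) `^ (- 2^-1) * (qform (invmx A) w) `^ (- (m%:R / 2)).

Lemma integrated_gauss p m (S : 'M[R]_(p + m.+1)) (H : 'M[R]_(p + m.+1, p))
    (W : 'M[R]_(p + m.+1, m.+1)) y :
  posdef S -> H^T *m W = 0 -> W^T *m W = 1%:M ->
  (forall v : 'cV_p, H *m v = 0 -> v = 0) -> W^T *m y != 0 ->
  (\int[mu]_(s in `]0%R, +oo[)
     (integral_Rn (fun be : 'cV[R]_p => (gauss_density S H y s be)%:E) * (s^-1)%:E) =
   ((\det (H^T *m H)) `^ (- 2^-1) * (2 * pi) `^ (- (m.+1%:R / 2)) *
    profile (W^T *m S *m W) (W^T *m y))%:E *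
   \int[mu]_(t in Rpos) (2 * t ^+ m * expR (- (t ^+ 2 / 2)))%:E)%E.
Proof.
move=> pS HW WW injH Wy.
have pP := posdef_normal pS injH; have pQ := posdef_projected pS WW.
have [_ /(_ _ Wy) q0] := posdef_invmx pQ; rewrite /profile.
have dS := posdef_det_gt0 pS; have dP := posdef_det_gt0 pP.
have dQ := posdef_det_gt0 pQ; have dH := posdef_det_gt0 (posdef_gram injH).
set q := qform _ _ in q0 *.
set a : R := - (m.+1%:R / 2).
set K := (\det (H^T *m H)) `^ (- 2^-1) * (\det (W^T *m S *m W)) `^ (- 2^-1).
have K0 : 0 <= K by rewrite mulr_ge0 ?powR_ge0.
transitivity (\int[mu]_(s in Rpos)
    (K%:E * ((2 * pi * s) `^ a * expR (- (2 * s)^-1 * q) * s^-1)%:E))%E.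
  apply: eq_integral => s; rewrite inE RposE => s0.
  have pis : 0 < 2 * pi * s :> R by rewrite !mulr_gt0 ?pi_gt0.
  under [X in integral_Rn X]eq_fun do rewrite gauss_densityE//.
  rewrite integral_Rn_gauss//; last 2 first.
  - by rewrite invr_gt0 mulr_gt0.
  - by rewrite mulr_ge0 ?powR_ge0.
  rewrite -!EFinM; congr (_%:E).
  rewrite (qform_profile pS HW WW injH) -/q.
  have -> : pi / (2 * s)^-1 = 2 * pi * s by rewrite invrK; ring.
  have -> : (2 * pi * s) `^ a =
     (2 * pi * s) `^ (- ((p + m.+1)%:R / 2)) * (2 * pi * s) `^ (p%:R / 2).
    have pn : 2 * pi * s != 0 by rewrite gt_eqF.
    rewrite -powRD; last by rewrite pn implybT.
    by rewrite /a natrD; congr powR; field.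
  have -> : K = (\det S) `^ (- 2^-1) * (\det (H^T *m invmx S *m H)) `^ (- 2^-1).
    by rewrite /K mulrC -!powRM ?ltW// -(det_profile pS HW WW injH).
  ring.
rewrite ge0_integralZl_EFin//; last 2 first.
- move=> s; rewrite RposE => s0.
  by rewrite lee_fin !mulr_ge0 ?powR_ge0 ?expR_ge0// invr_ge0 ltW.
- apply/measurable_EFinP; apply: measurable_pos => s; exact: continuous_scale.
rewrite scale_mixture// muleA -EFinM; congr (_%:E * _)%E; rewrite /K -/a; ring.
Qed.

End IntegratedLikelihood.

(** * Limit of the likelihood *)

Section LikelihoodLimit.
Context {R : realType}.

Lemma profile_gt0 m (A : 'M[R]_m) w : posdef A -> w != 0 -> 0 < profile A w.
Proof.
move=> pA w0; have [_ /(_ _ w0) q0] := posdef_invmx pA.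
by rewrite mulr_gt0 ?powR_gt0// posdef_det_gt0.
Qed.

(** The determinant contributes e^(- m / 2) and the quadratic form e^(m / 2). *)
Lemma profileZ m (e : R) (A : 'M[R]_m) w : 0 < e -> posdef A -> w != 0 ->
  profile (e *: A) w = profile A w.
Proof.
move=> e0 pA w0; have [_ /(_ _ w0) q0] := posdef_invmx pA.
have uA := posdef_unit pA; have dA := posdef_det_gt0 pA.
rewrite /profile invmxZ; last by rewrite unitmxZ ?unitfE ?gt_eqF.
have -> : qform (e^-1 *: invmx A) w = e^-1 * qform (invmx A) w.
  by rewrite /qform -scalemxAr -scalemxAl mxE.
rewrite detZ powRM ?exprn_ge0 ?(ltW e0) ?(ltW dA)//.
rewrite powRM ?invr_ge0 ?(ltW e0) ?(ltW q0)//.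
have -> : (e ^+ m) `^ (- 2^-1) = e `^ (- (m%:R / 2)).
  by rewrite -(powR_mulrn m (ltW e0)) -powRrM mulrN.
have -> : e^-1 `^ (- (m%:R / 2)) = (e `^ (- (m%:R / 2)))^-1.
  by rewrite -(powR_inv1 (ltW e0)) -powRrM mulN1r opprK powRN invrK.
by field; rewrite gt_eqF// powR_gt0.
Qed.

Lemma cvg_profile (T : Type) (F : set_system T) {FF : Filter F} m
    (A : T -> 'M[R]_m) A0 w : posdef A0 -> w != 0 -> mxcvg F A A0 ->
  profile (A t) w @[t --> F] --> profile A0 w.
Proof.
move=> pA w0 cA; have [_ /(_ _ w0) q0] := posdef_invmx pA.
have cpow (a x : R) : 0 < x -> {for x, continuous (fun x => x `^ a)}.
  move=> x0; apply/differentiable_continuous/derivable1_diffP/derivable_powR.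
  by rewrite in_itv/= andbT.
apply: cvgM.
  apply: (cvg_comp _ (fun x => x `^ (- 2^-1)) (cvg_det cA)).
  exact/cpow/posdef_det_gt0.
apply: (cvg_comp (fun t => qform (invmx (A t)) w) (fun x => x `^ (- (m%:R / 2)))).
  apply: mxcvg_mul; last exact: mxcvg_cst.
  apply: mxcvg_mul; first exact: mxcvg_cst.
  by apply: mxcvg_inv => //; exact: posdef_unit.
exact: cpow.
Qed.

Lemma likelihood_cvg (n r m : nat) (X : 'M[R]_(n, r)) (W : 'M[R]_(n, m.+1))
    (y : 'cV[R]_n) :
  n = (r.+1 + m.+1)%N -> injective (fun i => row i X) ->
  \rank (affineH X) = r.+1 -> W^T *m W = 1%:M -> (affineH X)^T *m W = 0 ->
  W^T *m y != 0 ->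
  exists l : R, l != 0 /\ likelihood 1 X y theta @[theta --> +oo_R] --> l%:E.
Proof.
move=> nE; subst n => injX rH WW HW Wy.
have injH (v : 'cV_r.+1) : affineH X *m v = 0 -> v = 0.
  move=> Hv; have fH : row_free (affineH X)^T by rewrite /row_free mxrank_tr rH.
  apply: trmx_inj; rewrite trmx0; apply: (row_free_inj fH).
  by rewrite mul0mx -trmx_mul Hv trmx0.
have [M M0 ME] := @gauss_moment R m.
have dH := posdef_det_gt0 (posdef_gram injH).
pose C := (\det ((affineH X)^T *m affineH X)) `^ (- 2^-1) *
  (2 * pi) `^ (- (m.+1%:R / 2)) : R.
have C0 : 0 < C by rewrite mulr_gt0 ?powR_gt0// mulr_gt0 ?pi_gt0.
have pM := contrast_mx0_posdef injX WW HW.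
exists (C * profile (contrast_mx0 X W) (W^T *m y) * M); split.
  by rewrite gt_eqF// mulr_gt0// mulr_gt0// profile_gt0.
have cp : C * profile (contrast_mx X W 2 (th ^- 2)) (W^T *m y) * M @[th --> +oo] -->
    C * profile (contrast_mx0 X W) (W^T *m y) * M.
  apply: cvgM; last exact: cvg_cst.
  apply: cvgM; first exact: cvg_cst.
  apply: (@cvg_comp _ _ _ (fun th : R => th ^- 2)
    (fun e => profile (contrast_mx X W 2 e) (W^T *m y)) _ _ _ (@cvg_invX2 R)).
  by apply: cvg_profile => //; exact: cvg_contrast_mx2.
have : (C * profile (contrast_mx X W 2 (th ^- 2)) (W^T *m y) * M)%:E @[th --> +oo_R] -->
    (C * profile (contrast_mx0 X W) (W^T *m y) * M)%:E.
  by apply: cvg_EFin => //; exact: nearW.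
apply: cvg_trans; apply: near_eq_cvg; near=> th.
have th0 : 0 < th by near: th; exact: nbhs_pinfty_gt.
have e0 : 0 < th ^- 2 by rewrite invr_gt0 exprn_gt0.
rewrite /likelihood (integrated_gauss (Sigma_posdef injX th0) HW WW injH Wy) ME.
have -> : profile (W^T *m Sigma 1 X th *m W) (W^T *m y) =
    profile (contrast_mx X W 2 (th ^- 2)) (W^T *m y).
  have pF := contrast_mx_posdef injX WW e0.
  by rewrite -(profileZ e0 pF Wy) -(SigmaW_contrast_mx X W th0).
by rewrite EFinM.
Unshelve. all: by end_near. Qed.

End LikelihoodLimit.

Theorem propositionB2 (R : realType) (r n : nat) (hr : (1 <= r)%N)
  (hn : (r.+1 < n)%N) (X : 'M[R]_(n, r))
  (hX : injective (fun i : 'I_n => row i X))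
  (hH : \rank (affineH X) = r.+1)
  (W : 'M[R]_(n, n - r.+1))
  (hW : W^T *m W = 1%:M)
  (hHW : (affineH X)^T *m W = 0) :
  [/\ refprior 1 X W =O_ (pinfty_nbhs R) (fun theta : R => theta ^- 3 * ln theta),
      measurable_fun (`]0, +oo[ : set R) (refprior 1 X W),
      (\int[@lebesgue_measure R]_(theta in `]0%R, +oo[)
         (refprior 1 X W theta)%:E < +oo)%E
    & forall y : 'cV[R]_n, W^T *m y != 0 ->
        exists l : R, l != 0 /\
          likelihood 1 X y theta @[theta --> +oo_R] --> l%:E].
Proof.
have m0 : (0 < n - r.+1)%N by rewrite subn_gt0.
have nE : n = (r.+1 + (n - r.+1))%N by rewrite subnKC// ltnW.
(* n = r.+1 + m.+1, so that H and W fit side by side in a square matrix *)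
move: (n - r.+1)%N m0 nE W hW hHW => [//|m] m0 nE W hW hHW; split.
- exact: refprior_bigO.
- exact: measurable_refprior.
- exact: refprior_integral.
- by move=> y; exact: likelihood_cvg.
Qed.
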